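(* Let $G$ be a bridgeless graph, let $P=\{C : C=\partial_G(X) \text{ for some } X\subset V(G),\ |C|=3\}$ be the set of 3-edge-cuts of $G$, and let $Q=\{C : C=\partial_G(X)\text{ for some } X\subset V(G),\ |C|=5\}$ be the set of 5-edge-cuts of $G$. If $2|P|+|Q|\leq 7$, then $G$ has a modulo 3-orientation (and therefore has a nowhere-zero 3-flow).
   Context: Graphs are finite and loopless, but may have multiple edges. For $X\subset V(G)$, $\partial_G(X)$ denotes the set of edges of $G$ with one end in $X$ and the other in $V(G)\setminus X$ (the edge-cut associated with $X$); it is called a $k$-edge-cut if $|\partial_G(X)|=k$. Edge-cuts are counted as edge sets. For an orientation $D$ of $E(G)$ and a vertex $v$, $\partial_D^+(v)$ (resp. $\partial_D^-(v)$) is the set of arcs with tail (resp. head) $v$, and $d_D^+(v)=|\partial_D^+(v)|$, $d_D^-(v)=|\partial_D^-(v)|$. A modulo 3-orientation of $G$ is an orientation $D$ of $E(G)$ such that $d_D^+(v)-d_D^-(v)\equiv 0\pmod 3$ for every vertex $v\in V(G)$. A nowhere-zero 3-flow of $G$ is a pair $(D,f)$ where $D$ is an orientation of $E(G)$ and $f:E(G)\to\{\pm1,\pm2\}$ satisfies $\sum_{e\in\partial_D^+(v)}f(e)=\sum_{e\in\partial_D^-(v)}f(e)$ for every $v\in V(G)$. *)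

(* Defs.v *)
From mathcomp Require Import all_boot all_order all_algebra.

Set Implicit Arguments.
Unset Strict Implicit.
Unset Printing Implicit Defensive.

Import GRing.Theory.

(* Finite loopless multigraphs: distinct edges may have the same set of ends,
   and looplessness is the requirement that every edge has two distinct ends. *)
Record multigraph := Multigraph {
  vertex : finType;
  edge : finType;
  ends : edge -> {set vertex};
  card_ends : forall e, #|ends e| = 2
}.

Definition edge_cut (G : multigraph) (X : {set vertex G}) : {set edge G} :=
  [set e | [exists x in X, exists y in ~: X, ends e == [set x; y]]].

(* Cuts are counted as edge sets, so X and its complement, or any other sets
   with the same boundary, contribute only one element. *)
Definition edge_cuts (G : multigraph) (k : nat) : {set {set edge G}} :=
  [set C | [exists X : {set vertex G}, C == edge_cut X] && (#|C| == k)].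

Definition adj_without (G : multigraph) (e : edge G) : rel (vertex G) :=
  [rel x y | [exists e', (e' != e) && (ends e' == [set x; y])]].

(* A bridge is an edge whose ends are separated by its deletion. *)
Definition bridge (G : multigraph) (e : edge G) : bool :=
  [exists x in ends e, exists y in ends e, ~~ connect (adj_without e) x y].

Definition bridgeless (G : multigraph) : Prop := forall e : edge G, ~~ bridge e.

Record orientation (G : multigraph) := Orientation {
  tail : edge G -> vertex G;
  head : edge G -> vertex G;
  tail_head : forall e, ends e = [set tail e; head e]
}.

Definition out_arcs (G : multigraph) (D : orientation G) (v : vertex G) :
  {set edge G} := [set e | tail D e == v].

Definition in_arcs (G : multigraph) (D : orientation G) (v : vertex G) :
  {set edge G} := [set e | head D e == v].

Definition mod3_orientation (G : multigraph) (D : orientation G) : Prop :=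
  forall v : vertex G,
    (#|out_arcs D v|%:Z - #|in_arcs D v|%:Z = 0 %[mod 3])%Z.

Definition nowhere_zero_3flow (G : multigraph) (D : orientation G)
    (f : edge G -> int) : Prop :=
  (forall e, f e \in [:: 1; -1; 2; -2]%R) /\
  (forall v : vertex G,
     (\sum_(e in out_arcs D v) f e = \sum_(e in in_arcs D v) f e)%R).

(* Main.v *)
Require Import Defs.
From mathcomp Require Import all_boot all_order all_algebra zify.

Set Implicit Arguments.
Unset Strict Implicit.
Unset Printing Implicit Defensive.

Import Order.TTheory GRing.Theory Num.Theory.
Local Open Scope nat_scope.

(** A 3-cut or 5-cut is exactly what prevents a graph without 0-, 1- and 2-cuts
    from satisfying the hypothesis of the theorem of Lovasz, Thomassen, Wu and
    Zhang on modulo 3-orientations.  That theorem prescribes a boundary (the net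
    outflow of each vertex modulo 3) and the directions of the edges at one
    vertex z0.  If tau(A) measures how far the prescribed boundary of A is from
    being met with the parity of d(A), then d(z0) <= 4 + |tau(z0)| and
    d(A) >= 4 + |tau(A)| for the sets A avoiding z0 suffice for an extension to all
    edges.  With boundary zero the condition reads d(A) >= 4 for even cuts and
    d(A) >= 7 for odd ones.

    Reduction to that theorem (balanced_few_cuts).  In a smallest bad graph there
    are no 0- and 2-cuts (identify two vertices on opposite sides and repair one
    edge), and every 3-cut has a single vertex on one side, since up to reversal
    a balanced orientation is unique on a 3-cut and orientations of the two
    contractions can be glued.  If a side A of a 3- or 5-cut contained no vertex
    of degree 3 or 5, a minimal such A could be contracted, and the theorem would
    extend the orientation into A, with the cut as pre-oriented edges.
    So each side of each small cut contains a vertex of degree 3 or 5, and if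
    there are more than two vertices, distinct ones have distinct boundaries.  Now
    join a new vertex z0 to each vertex of degree 3 by two parallel arcs and to each
    vertex of degree 5 by one arc (by two if at most two vertices are joined).  This
    lifts every cut to the bound of the theorem.  There are at most 4 or at
    most 2|P| + |Q| <= 7 arcs at z0, and 7 arcs are allowed when 5 of them leave z0
    and 2 enter it, or conversely (signed_weights, solve_weighted).

    The extension theorem itself (orientation_extension) is proved by induction.
    Taking the boundary modulo 6, with the parity of the degrees, makes
    |tau| the distance to 6Z; deleting an oriented edge then changes both d and
    |tau| by one at each end.  In a minimal counterexample every set A of at least
    two vertices, other than V - z0, satisfies d(A) >= 6 + |tau(A)|, for otherwise A
    can be contracted and the orientation extended into A (solve_tight).  With
    this slack, a vertex of boundary 0 can be lifted away (solve_zero), and an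
    edge whose orientation brings both ends closer to 6Z can be deleted.
    Connectedness then forces all boundaries to have one sign, say to be 1 or 2,
    with d(x) = 4 + tau(x), and all arcs of z0 to leave z0.  Finally a
    neighbour x of z0 (any x if z0 is isolated) is merged into z0, with five arcs
    entering x in total, and two of them that do not come from z0 are deleted.  The
    deletion is affordable because even d(A) >= 6 + |tau(A) - 2| holds
    (solve_leaving, solve_absorb).

    A modulo 3-orientation carries a 3-flow: start from the values 1, whose excess
    is divisible by 3 at each vertex, and move excess along paths by exchanging
    the values 1 and -2 (three_flow_exists). *)

(** For b of the parity of d(A), this is the least absolute value of an integer
    congruent to the boundary of A modulo 3 and to d(A) modulo 2. *)
Definition dist6 (b : int) : nat :=
  minn `|(b %% 6)%Z|%N (6 - `|(b %% 6)%Z|%N).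

Lemma dist6_le_succ (b c : int) : (b - c = 1 \/ c - b = 1)%R -> dist6 b <= (dist6 c).+1.
Proof. rewrite /dist6; lia. Qed.

Lemma dist6_eq (b c : int) : (6 %| (b - c)%R)%Z -> dist6 b = dist6 c.
Proof. rewrite /dist6; lia. Qed.

Lemma dist6_subadd (b c : int) : dist6 (b + c)%R <= dist6 b + dist6 c.
Proof. rewrite /dist6; lia. Qed.

(** * Cuts and net outflow of lists of edges *)

Section EdgeLists.
Variable V : finType.
Implicit Types (e a : V * V) (E F D Z L : seq (V * V)) (A B W : {set V}) (b : V -> int).

Definition ends_of e : {set V} := [set e.1; e.2].
(** An orientation of a list of edges E is a list D with same_graph E D: order and
    directions are forgotten together, so both can be changed freely. *)
Definition same_graph E F : bool := perm_eq (map ends_of E) (map ends_of F).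
Definition rev_arc e : V * V := (e.2, e.1).

(** Loops are allowed and never counted. *)
Definition cut_size E A : nat := count (fun e => (e.1 \in A) (+) (e.2 \in A)) E.
Definition outflow D A : int :=
  (\sum_(a <- D) ((a.1 \in A : nat)%:Z - (a.2 \in A : nat)%:Z))%R.
Definition sum_on b A : int := (\sum_(x in A) b x)%R.
Local Arguments cut_size : simpl never.

Lemma ends_ofP e e' : ends_of e = ends_of e' -> e = e' \/ e = rev_arc e'.
Proof.
case: e e' => [x y] [u v] eq; rewrite /ends_of /= in eq.
have xP : x \in [set u; v] by rewrite -eq !inE eqxx.
have yP : y \in [set u; v] by rewrite -eq !inE eqxx orbT.
have uP : u \in [set x; y] by rewrite eq !inE eqxx.
have vP : v \in [set x; y] by rewrite eq !inE eqxx orbT.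
case/set2P: xP uP vP {eq} => ->; case/set2P: yP => ->; rewrite !inE ?orbb.
- by move=> _ /eqP ->; left.
- by left.
- by right.
by move=> /eqP -> _; left.
Qed.

Lemma ends_of_rev e : ends_of (rev_arc e) = ends_of e.
Proof. by rewrite /ends_of setUC. Qed.

Lemma same_graph_refl E : same_graph E E. Proof. exact: perm_refl. Qed.
Lemma same_graph_sym E F : same_graph E F = same_graph F E. Proof. exact: perm_sym. Qed.
Lemma same_graph_trans : transitive same_graph.
Proof. by move=> F E L; apply: perm_trans. Qed.
Lemma same_graph_perm E F : perm_eq E F -> same_graph E F.
Proof. exact: perm_map. Qed.
Lemma same_graph_cat E E' F F' : same_graph E F -> same_graph E' F' -> same_graph (E ++ E') (F ++ F').
Proof. by rewrite /same_graph !map_cat; apply: perm_cat. Qed.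
Lemma same_graph_cons e E F : same_graph E F -> same_graph (e :: E) (e :: F).
Proof. by rewrite /same_graph /= perm_cons. Qed.
Lemma same_graph_rev e E F : same_graph E F -> same_graph (e :: E) (rev_arc e :: F).
Proof. by rewrite /same_graph /= ends_of_rev perm_cons. Qed.
Lemma same_graph_size E F : same_graph E F -> size E = size F.
Proof. by move/perm_size; rewrite !size_map. Qed.

Lemma same_graph_all (P : pred (V * V)) E F :
  (forall e, P (rev_arc e) = P e) -> same_graph E F -> all P E = all P F.
Proof.
move=> Prev /perm_mem eqEF.
suff imp E1 E2 : map ends_of E1 =i map ends_of E2 -> all P E1 -> all P E2.
  by apply/idP/idP; apply: imp => // x; rewrite eqEF.
move=> eq12 /allP P1; apply/allP => e e2.
have: ends_of e \in map ends_of E1 by rewrite eq12 map_f.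
by case/mapP=> e' e'1 /ends_ofP [->|->]; rewrite ?Prev; apply: P1.
Qed.

Lemma cut_size_cat E F A : cut_size (E ++ F) A = cut_size E A + cut_size F A.
Proof. exact: count_cat. Qed.
Lemma cut_size_cons e E A : cut_size (e :: E) A = ((e.1 \in A) (+) (e.2 \in A)) + cut_size E A.
Proof. by []. Qed.
Lemma cut_size_nil A : cut_size [::] A = 0. Proof. by []. Qed.
Lemma cut_size_perm E F A : perm_eq E F -> cut_size E A = cut_size F A.
Proof. by move/permP; apply. Qed.

(** Expressing the cut through the unordered ends shows that it is invariant
    under same_graph. *)
Lemma cut_size_ends_of E A :
  cut_size E A = count (fun s : {set V} => ~~ [disjoint s & A] && ~~ (s \subset A)) (map ends_of E).
Proof.
rewrite count_map; apply: eq_count => -[x y] /=.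
rewrite /ends_of /= subUset !sub1set -setI_eq0 setIUl setU_eq0 !setI_eq0 !disjoints1.
by case: (x \in A); case: (y \in A).
Qed.

Lemma cut_size_same E F A : same_graph E F -> cut_size E A = cut_size F A.
Proof. by move=> /permP s; rewrite !cut_size_ends_of s. Qed.

Lemma cut_size_map (f : V -> V) E A :
  cut_size [seq (f e.1, f e.2) | e <- E] A = cut_size E (f @^-1: A).
Proof. by rewrite /cut_size count_map; apply: eq_count => e; rewrite /= !inE. Qed.

Lemma outflow_nil A : outflow [::] A = 0%R. Proof. by rewrite /outflow big_nil. Qed.
Lemma outflow_cons a D A :
  outflow (a :: D) A = ((a.1 \in A : nat)%:Z - (a.2 \in A : nat)%:Z + outflow D A)%R.
Proof. by rewrite /outflow big_cons. Qed.
Lemma outflow_cat D F A : outflow (D ++ F) A = (outflow D A + outflow F A)%R.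
Proof. by rewrite /outflow big_cat. Qed.
Lemma outflow_perm D F A : perm_eq D F -> outflow D A = outflow F A.
Proof. by move=> p; apply: perm_big. Qed.
Lemma outflow_map (f : V -> V) E A :
  outflow [seq (f e.1, f e.2) | e <- E] A = outflow E (f @^-1: A).
Proof. by rewrite /outflow big_map; apply: eq_bigr => e _; rewrite !inE. Qed.
Lemma outflow_rev D A : outflow (map rev_arc D) A = (- outflow D A)%R.
Proof.
elim: D => [|a D IH]; rewrite ?outflow_nil //= !outflow_cons IH /=; lia.
Qed.

Lemma in_sum_pred1 x A : (x \in A : nat) = \sum_(y in A) (x \in [set y] : nat).
Proof.
case: (boolP (x \in A)) => xA.
  rewrite (bigD1 x) //= inE eqxx big1 // => y /andP[_ ny].
  by rewrite inE eq_sym (negbTE ny).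
rewrite big1 // => y yA; rewrite inE; case: eqP => // xy.
by rewrite xy yA in xA.
Qed.

Lemma outflow_sum D A : outflow D A = (\sum_(x in A) outflow D [set x])%R.
Proof.
rewrite /outflow exchange_big /=; apply: eq_bigr => a _.
by rewrite (in_sum_pred1 a.1) (in_sum_pred1 a.2) sumrB !(big_morph Posz PoszD (erefl _)).
Qed.

Lemma sum_on1 b x : sum_on b [set x] = b x.
Proof. by rewrite /sum_on big_set1. Qed.
Lemma sum_onU b A B : [disjoint A & B] -> sum_on b (A :|: B) = (sum_on b A + sum_on b B)%R.
Proof.
by move=> dAB; rewrite /sum_on -bigU //=; apply: eq_bigl => x; rewrite !inE.
Qed.
Lemma outflowU D A B : [disjoint A & B] -> outflow D (A :|: B) = (outflow D A + outflow D B)%R.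
Proof. by move=> dAB; rewrite !(outflow_sum D); apply: sum_onU. Qed.
Lemma sum_onD1 b x A : x \in A -> sum_on b A = (b x + sum_on b (A :\ x))%R.
Proof. by move=> xA; rewrite /sum_on (big_setD1 x). Qed.
Lemma outflowD1 D x A : x \in A -> outflow D A = (outflow D [set x] + outflow D (A :\ x))%R.
Proof. by move=> xA; rewrite (outflow_sum D A) (big_setD1 x) //= -outflow_sum. Qed.

Lemma outflow_parity D A : (2 %| (outflow D A - (cut_size D A)%:Z)%R)%Z.
Proof.
elim: D => [|a D]; rewrite ?outflow_nil ?cut_size_nil //= outflow_cons cut_size_cons.
by case: (_ \in A); case: (_ \in A) => /=; lia.
Qed.

Lemma outflow_eq_sum_on (n : int) D b A :
  (forall x, x \in A -> (n %| (outflow D [set x] - b x)%R)%Z) -> (n %| (outflow D A - sum_on b A)%R)%Z.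
Proof.
by move=> h; rewrite outflow_sum /sum_on -sumrB; apply: rpred_sum => x /h.
Qed.

End EdgeLists.

Arguments cut_size : simpl never.
Arguments dist6 : simpl never.
Arguments rev_arc {V} e.

(** Lifts a permutation of images to one of preimages; it is how an orientation of
    an image graph is pulled back. *)
Lemma perm_map_align (T1 T2 T3 : eqType) (f : T1 -> T3) (g : T2 -> T3) s1 s2 :
  perm_eq (map f s1) (map g s2) ->
  exists2 s, perm_eq s1 s & map f s = map g s2.
Proof.
elim: s2 s1 => [|y s2 IH] s1.
  by move/perm_size; rewrite size_map /= => /size0nil ->; exists [::].
move=> p; have: g y \in map f s1 by rewrite (perm_mem p) /= mem_head.
case/mapP => x xs1 gy.
have px : perm_eq s1 (x :: rem x s1) by apply: perm_to_rem.
have: perm_eq (map f (rem x s1)) (map g s2).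
  rewrite -(perm_cons (g y)) -[_ :: map g s2]/(map g (y :: s2)).
  by rewrite -(permPr p) gy -/(map f (x :: _)) perm_map // perm_sym.
case/IH => s ps fs; exists (x :: s); last by rewrite /= fs gy.
by apply: (perm_trans px); rewrite perm_cons.
Qed.

(** * Orientation problems with prescribed boundary *)

Section Instances.
Variable V : finType.
Implicit Types (e a : V * V) (E F D Z L : seq (V * V)) (A B W : {set V}) (b : V -> int).

Lemma same_graph_consP e E D : same_graph (e :: E) D ->
  exists a D', [/\ perm_eq D (a :: D'), a = e \/ a = rev_arc e & same_graph E D'].
Proof.
rewrite /same_graph perm_sym => /perm_map_align[[|a D'] pD] //= [ea eD].
exists a, D'; split => //; first exact: ends_ofP.
by rewrite eD.
Qed.

(** Normal form for working at one vertex: its edges can be listed as pairs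
    starting from it. *)
Lemma star_decomposition E x : all (fun e => e.1 != e.2) E ->
  exists ys E', [/\ same_graph E (map (pair x) ys ++ E'), x \notin ys &
    all (fun e => (e.1 != x) && (e.2 != x)) E'].
Proof.
elim: E => [|[u v] E IH] /=; first by exists [::], [::]; rewrite same_graph_refl.
case/andP => nuv /IH [ys [E' [sE xys hE']]].
case: (eqVneq u x) => [ux|nux].
  exists (v :: ys), E'; split => //; first by rewrite /= ux same_graph_cons.
  by rewrite inE negb_or -ux nuv ux.
case: (eqVneq v x) => [vx|nvx].
  exists (u :: ys), E'; split => //; first by rewrite /= -vx -[(v, u)]/(rev_arc (u, v)) vx same_graph_rev.
  by rewrite inE negb_or eq_sym nux.
exists ys, ((u, v) :: E'); split => //=; last by rewrite nux nvx.
apply: (same_graph_trans (same_graph_cons _ sE)); apply: same_graph_perm.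
by rewrite perm_sym -cat1s perm_catCA.
Qed.

(** The free edges E are to be oriented so that, together with the pre-oriented
    arcs Z, each vertex x of W has outflow b x modulo 6.  Everything outside W plays
    the role of the root z0; no vertex has to represent it. *)
Definition solvable W E Z b : Prop :=
  exists2 D, same_graph E D &
    forall x, x \in W -> (6 %| (outflow (D ++ Z) [set x] - b x)%R)%Z.

(** The last field is the boundary condition at the root: free edges lie inside W, so
    the outflow of W comes from Z alone. *)
Record well_formed W E Z b : Prop := Wf {
  well_formed_free : all (fun e => [&& e.1 \in W, e.2 \in W & e.1 != e.2]) E;
  well_formed_fixed : all (fun a => ~~ ((a.1 \in W) && (a.2 \in W))) Z;
  well_formed_par : forall x, x \in W -> (2 %| (b x - (cut_size (E ++ Z) [set x])%:Z)%R)%Z;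
  well_formed_sum : (6 %| (sum_on b W - outflow Z W)%R)%Z }.

(** A vertex v0 of boundary zero is exempt from the cut condition, so that edges can
    be lifted at it one pair at a time until it is isolated.  No vertex is exempt
    if v0 has nonzero boundary or lies outside W. *)
Record admissible W E Z b (v0 : V) : Prop := Good {
  admissible_wf :> well_formed W E Z b;
  admissible_root : cut_size Z W <= 4 + dist6 (sum_on b W);
  admissible_cut : forall A, A \subset W -> A != set0 -> A != W ->
    4 + dist6 (sum_on b A) <= cut_size (E ++ Z) A \/ (A = [set v0] /\ (6 %| b v0)%Z) }.

Lemma solvable_same W E F Z b : same_graph E F -> solvable W F Z b -> solvable W E Z b.
Proof. by move=> s [D sF h]; exists D => //; apply: same_graph_trans sF. Qed.

Lemma solvable_perm W E Z Z' b :
  perm_eq Z Z' -> solvable W E Z' b -> solvable W E Z b.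
Proof.
move=> p [D s h]; exists D => // x /h.
by rewrite (@outflow_perm _ (D ++ Z') (D ++ Z)) // perm_cat2l perm_sym.
Qed.

Lemma well_formed_same W E F Z Z' b : same_graph E F -> perm_eq Z Z' ->
  well_formed W E Z b -> well_formed W F Z' b.
Proof.
move=> s p [h1 h2 h3 h4].
split.
- rewrite -(same_graph_all _ s) // => -[u v] /=.
  by rewrite andbCA (eq_sym v).
- by rewrite -(perm_all _ p).
- by move=> x xW; rewrite cut_size_cat -(cut_size_same _ s) -(cut_size_perm _ p) -cut_size_cat; apply: h3.
by rewrite -(outflow_perm _ p).
Qed.

Lemma admissible_same W E F Z Z' b v0 : same_graph E F -> perm_eq Z Z' ->
  admissible W E Z b v0 -> admissible W F Z' b v0.
Proof.
move=> s p [h1 h2 h3]; split; first exact: well_formed_same h1.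
- by rewrite -(cut_size_perm _ p).
by move=> A; rewrite cut_size_cat -(cut_size_same _ s) -(cut_size_perm _ p) -cut_size_cat; apply: h3.
Qed.

Lemma par_set W E Z b A : well_formed W E Z b -> A \subset W ->
  (2 %| (sum_on b A - (cut_size (E ++ Z) A)%:Z)%R)%Z.
Proof.
move=> g sAW; have := outflow_parity (E ++ Z) A.
suff: (2 %| (outflow (E ++ Z) A - sum_on b A)%R)%Z by lia.
apply: outflow_eq_sum_on => x xA; have := outflow_parity (E ++ Z) [set x].
have := well_formed_par g (subsetP sAW x xA); lia.
Qed.

Lemma abs_net_le L A : `|outflow L A|%N <= cut_size L A.
Proof.
elim: L => [|a L]; rewrite ?outflow_nil ?cut_size_nil // outflow_cons cut_size_cons.
by case: (_ \in A); case: (_ \in A) => /=; lia.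
Qed.

Lemma outflow_in L A : all (fun e => (e.1 \in A) && (e.2 \in A)) L -> outflow L A = 0%R.
Proof.
elim: L => [|a L IH] /=; rewrite ?outflow_nil // outflow_cons.
by case/andP => /andP[-> ->] /IH ->.
Qed.

Lemma cut_size_in L A : all (fun e => (e.1 \in A) && (e.2 \in A)) L -> cut_size L A = 0.
Proof.
elim: L => [|a L IH] //=; rewrite cut_size_cons.
by case/andP => /andP[-> ->] /IH ->.
Qed.

Lemma outflow_out L A : all (fun e => (e.1 \notin A) && (e.2 \notin A)) L -> outflow L A = 0%R.
Proof.
elim: L => [|a L IH] /=; rewrite ?outflow_nil // outflow_cons.
by case/andP => /andP[/negbTE -> /negbTE ->] /IH ->.
Qed.

Lemma cut_size_out L A : all (fun e => (e.1 \notin A) && (e.2 \notin A)) L -> cut_size L A = 0.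
Proof.
elim: L => [|a L IH] //=; rewrite cut_size_cons.
by case/andP => /andP[/negbTE -> /negbTE ->] /IH ->.
Qed.

(** Arcs of Z never join two vertices of W, so their cuts are additive. *)
Lemma cut_size_fixedU Z W A B : all (fun a => ~~ ((a.1 \in W) && (a.2 \in W))) Z ->
  [disjoint A & B] -> A :|: B \subset W -> cut_size Z (A :|: B) = cut_size Z A + cut_size Z B.
Proof.
move=> + dAB sW; elim: Z => [|[u v] Z IH] //= /andP[nuv /IH {}IH].
have inAB w : [&& ~~ ((w \in A) && (w \in B)) & (w \in A) || (w \in B) ==> (w \in W)].
  have := subsetP sW w; rewrite inE => h; apply/andP; split; last exact/implyP.
  by apply/andP => -[wA wB]; rewrite (disjointFr dAB wA) in wB.
rewrite !cut_size_cons IH /= !inE; have := inAB u; have := inAB v; move: nuv {inAB IH}.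
case: (u \in W); case: (v \in W) => //= _; rewrite ?implybF ?negb_or;
 case: (u \in A); case: (u \in B) => //=; case: (v \in A); case: (v \in B) => //=; lia.
Qed.

Lemma solve_one_vertex W E Z b : #|W| <= 1 -> well_formed W E Z b -> solvable W E Z b.
Proof.
move=> W1 g; exists E; first exact: same_graph_refl.
move=> x xW; have Wx : W = [set x].
  by apply/eqP; rewrite eq_sym eqEcard sub1set xW cards1.
have := well_formed_sum g; rewrite Wx sum_on1 outflow_cat (@outflow_in E); first lia.
by rewrite -Wx; apply: sub_all (well_formed_free g) => e /and3P[-> ->].
Qed.

Lemma cut_size_nseq n e A : cut_size (nseq n e) A = ((e.1 \in A) (+) (e.2 \in A)) * n.
Proof. by rewrite /cut_size count_nseq. Qed.

Lemma outflow_nseq n e A :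
  outflow (nseq n e) A = (((e.1 \in A : nat)%:Z - (e.2 \in A : nat)%:Z) * n%:Z)%R.
Proof.
elim: n => [|n IH]; first by rewrite outflow_nil mulr0.
rewrite /= outflow_cons IH; lia.
Qed.

(** Two parallel edges realize every residue modulo 6 of the right parity, and the
    degree conditions leave at most one edge only if one end has boundary zero. *)
Lemma solve_two_vertices W E Z b v0 : #|W| = 2 -> admissible W E Z b v0 -> solvable W E Z b.
Proof.
move/eqP/cards2P => [x [y [nxy Wxy]]] g.
have [|ys [E' [sE xys hE']]] := @star_decomposition E x.
  by apply: sub_all (well_formed_free g) => e /and3P[].
have g2 := admissible_same sE (perm_refl Z) g.
have := well_formed_free g2; rewrite all_cat => /andP[fy fE'].
have {hE' fE'} E'0 : E' = [::].
  case: E' hE' fE' {sE g2} => // -[u v] E' /= /andP[/andP[nu nv] _] /andP[/and3P[]].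
  rewrite Wxy !inE (negbTE nu) (negbTE nv) /= => /eqP -> /eqP ->.
  by rewrite eqxx.
have {fy} ys_y : ys = nseq (size ys) y.
  apply/all_pred1P; move: fy; rewrite all_map; apply: sub_all => z /=.
  by case/and3P => _; rewrite Wxy !inE; case: (eqVneq z x) => //= ->; rewrite eqxx.
set m := size ys in ys_y.
have {}sE : same_graph E (nseq m (x, y)).
  by move: sE; rewrite E'0 cats0 ys_y map_nseq.
have {g2} g := admissible_same sE (perm_refl Z) g.
apply: solvable_same sE _.
have bW : sum_on b W = (b x + b y)%R.
  by rewrite Wxy sum_onU ?disjoints1 ?inE // !sum_on1.
have zW : cut_size Z W = cut_size Z [set x] + cut_size Z [set y].
  by rewrite Wxy (cut_size_fixedU (well_formed_fixed g)) ?disjoints1 ?inE // Wxy.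
have nW : outflow Z W = (outflow Z [set x] + outflow Z [set y])%R.
  by rewrite Wxy outflowU // disjoints1 inE.
have hroot := admissible_root g; have hsum := well_formed_sum g.
rewrite bW zW in hroot; rewrite bW nW in hsum.
have xW : x \in W by rewrite Wxy !inE eqxx.
have yW : y \in W by rewrite Wxy !inE eqxx orbT.
have nyx : (y == x) = false by rewrite eq_sym (negbTE nxy).
have := well_formed_par g xW; have := well_formed_par g yW.
have := admissible_cut g (A := [set x]) _ _ _.
rewrite sub1set xW -cards_eq0 cards1 => /(_ isT isT).
have -> : [set x] != W.
  by apply/eqP => /setP/(_ y); rewrite Wxy !inE eqxx nyx orbT.
move=> /(_ isT); rewrite sum_on1 => cutx.
have := admissible_cut g (A := [set y]) _ _ _.
rewrite sub1set yW -cards_eq0 cards1 => /(_ isT isT).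
have -> : [set y] != W.
  by apply/eqP => /setP/(_ x); rewrite Wxy !inE eqxx (negbTE nxy).
move=> /(_ isT); rewrite sum_on1 => cuty.
move: cutx cuty; rewrite !cut_size_cat !cut_size_nseq !inE /= !eqxx nyx (negbTE nxy) /= !mul1n.
move=> cutx cuty pary parx.
have nx := abs_net_le Z [set x]; have ny := abs_net_le Z [set y].
have px := outflow_parity Z [set x]; have py := outflow_parity Z [set y].
have [p pm hp] : exists2 p, p <= m &
    (6 %| (2 * p%:Z - m%:Z - (b x - outflow Z [set x]))%R)%Z.
  (* p of the m parallel edges leave x; only p modulo 3 matters, and p <= 2. *)
  exists `|modz (divz (b x - outflow Z [set x] + m%:Z)%R 2) 3|%N.
    have hm : 1 < m \/ cut_size Z [set x] <= m <= 1 /\ (6 %| b x)%Z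
                    \/ cut_size Z [set y] <= m <= 1 /\ (6 %| b y)%Z.
      case: cutx => [cutx|[/set1_inj xv0 bv0]]; case: cuty => [cuty|[/set1_inj yv0 bv1]].
      - left; have := dist6_subadd (b x) (b y); lia.
      - rewrite -yv0 in bv1; have := @dist6_eq (b x + b y)%R (b x) ltac:(lia); lia.
      - rewrite -xv0 in bv0; have := @dist6_eq (b x + b y)%R (b y) ltac:(lia); lia.
      by rewrite xv0 yv0 eqxx in nxy.
    clear cutx cuty hroot.
    by case: hm => [|[[]|[]]]; lia.
  lia.
exists (nseq p (x, y) ++ nseq (m - p) (y, x)).
  have -> : nseq m (x, y) = nseq p (x, y) ++ nseq (m - p) (x, y).
    by rewrite -nseqD subnKC.
  apply: same_graph_cat; first exact: same_graph_refl.
  by rewrite /same_graph !map_nseq -[(y, x)]/(rev_arc (x, y)) ends_of_rev.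
move=> z; rewrite Wxy => /set2P[] ->; rewrite !outflow_cat !outflow_nseq !inE /=;
  rewrite ?eqxx ?nyx ?(negbTE nxy) /=; lia.
Qed.

End Instances.

Definition inside (V : finType) (A : {set V}) : pred (V * V) :=
  fun e => (e.1 \in A) && (e.2 \in A).
Local Notation edges_in A E := (filter (inside A) E).
Local Notation edges_off A E := (filter (predC (inside A)) E).

(** * Using an arc, restricting to a vertex set, contracting a vertex set *)

Section Moves.
Variable V : finType.
Implicit Types (e a : V * V) (E F D Z L : seq (V * V)) (A B W : {set V}) (b : V -> int).

Lemma same_graph_split A E : same_graph E (edges_in A E ++ edges_off A E).
Proof. by apply: same_graph_perm; rewrite perm_sym (perm_filterC (inside A) E). Qed.

Lemma cut_size_edges_off A B E : A \subset B -> cut_size (edges_off A E) B = cut_size E B.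
Proof.
move=> sAB; elim: E => [|e E IH] //=; rewrite cut_size_cons -IH /inside.
case: (boolP (e.1 \in A)) => [/(subsetP sAB) h1|_] /=; rewrite ?cut_size_cons //.
case: (boolP (e.2 \in A)) => [/(subsetP sAB) h2|_] /=; rewrite ?cut_size_cons //.
by rewrite h1 h2.
Qed.

(** What the vertices still require once the arc a has been used. *)
Definition demand_after b a : V -> int := fun x => (b x - outflow [:: a] [set x])%R.

Lemma sum_on_demand_after b a A : sum_on (demand_after b a) A = (sum_on b A - outflow [:: a] A)%R.
Proof. by rewrite (outflow_sum _ A) /sum_on -sumrB. Qed.

Lemma outflow_arc a A : outflow [:: a] A = ((a.1 \in A : nat)%:Z - (a.2 \in A : nat)%:Z)%R.
Proof. by rewrite outflow_cons outflow_nil addr0. Qed.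

Lemma demand_afterE b a x :
  demand_after b a x = (b x - ((a.1 == x : nat)%:Z - (a.2 == x : nat)%:Z))%R.
Proof. by rewrite /demand_after outflow_arc !inE. Qed.

Lemma solvable_drop W E Z b a :
  solvable W E Z (demand_after b a) -> solvable W E (a :: Z) b.
Proof.
case=> D sD h; exists D => // x /h.
by rewrite !outflow_cat outflow_cons /demand_after outflow_arc; lia.
Qed.

Lemma solvable_direct W E Z b a :
  solvable W E Z (demand_after b a) -> solvable W (a :: E) Z b.
Proof.
case=> D sD h; exists (a :: D); first exact: same_graph_cons.
move=> x /h; rewrite !outflow_cat outflow_cons /demand_after outflow_arc; lia.
Qed.

Lemma well_formed_drop W E Z b a : well_formed W E (a :: Z) b -> well_formed W E Z (demand_after b a).
Proof.
case=> h1 /= /andP[_ h2] h3 h4; split=> //.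
  move=> x /h3; have := outflow_parity [:: a] [set x].
  rewrite !cut_size_cat !cut_size_cons /demand_after cut_size_nil; lia.
by move: h4; rewrite sum_on_demand_after outflow_cons outflow_arc; lia.
Qed.

Lemma well_formed_direct W E Z b a : well_formed W (a :: E) Z b -> well_formed W E Z (demand_after b a).
Proof.
case=> /= /andP[/and3P[a1 a2 _] h1] h2 h3 h4; split=> //.
  move=> x /h3; have := outflow_parity [:: a] [set x].
  rewrite !cut_size_cons !cut_size_cat /demand_after cut_size_nil; lia.
by move: h4; rewrite sum_on_demand_after outflow_arc a1 a2; lia.
Qed.

(** For a set A, the edges not inside A become the pre-oriented arcs of an instance
    on A.  Nothing has to be contracted, since all vertices outside A act as the root. *)
Lemma well_formed_extend W E Z b A D : well_formed W E Z b -> A \subset W ->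
  same_graph (edges_off A E) D -> (6 %| (sum_on b A - outflow (D ++ Z) A)%R)%Z ->
  well_formed A (edges_in A E) (D ++ Z) b.
Proof.
move=> [h1 h2 h3 h4] sAW sD hA; split => //.
- apply/allP => e; rewrite mem_filter => /andP[/andP[-> ->] /(allP h1)].
  by case/and3P.
- rewrite all_cat; apply/andP; split; last first.
    apply: sub_all h2 => a; apply: contra => /andP[a1 a2].
    by rewrite !(subsetP sAW).
  rewrite -(same_graph_all _ sD); last by move=> a /=; rewrite andbC.
  by apply/allP => e; rewrite mem_filter => /andP[].
move=> x xA; have := h3 x (subsetP sAW x xA).
by rewrite !cut_size_cat -(cut_size_same _ sD) (cut_size_same _ (same_graph_split A E)) cut_size_cat addnA.
Qed.

Lemma cut_size_extend E Z A D B : same_graph (edges_off A E) D ->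
  cut_size (edges_in A E ++ D ++ Z) B = cut_size (E ++ Z) B.
Proof.
by move=> sD; rewrite !cut_size_cat -(cut_size_same _ sD) (cut_size_same B (same_graph_split A E)) cut_size_cat addnA.
Qed.

(** An orientation of the edges not inside A, correct outside A, is completed by a
    solution of the instance on A. *)
Lemma glue W E Z b A D : A \subset W -> same_graph (edges_off A E) D ->
  (forall x, x \in W :\: A -> (6 %| (outflow (D ++ Z) [set x] - b x)%R)%Z) ->
  solvable A (edges_in A E) (D ++ Z) b -> solvable W E Z b.
Proof.
move=> sAW sD hout [D' sD' hin]; exists (D' ++ D).
  by apply: (same_graph_trans (same_graph_split A E)); apply: same_graph_cat.
move=> x xW; rewrite -catA; case: (boolP (x \in A)) => [/hin //|xA].
have := hout x; rewrite inE xA xW => /(_ isT).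
rewrite (outflow_cat D') (@outflow_out _ D') ?add0r //.
rewrite -(same_graph_all _ sD'); last by move=> a /=; rewrite andbC.
apply/allP => e; rewrite mem_filter !inE => /andP[/andP[e1 e2] _].
by apply/andP; split; apply: contraNneq xA => <-.
Qed.

Section Contract.
Variables (W A : {set V}) (a0 : V) (E Z : seq (V * V)) (b : V -> int).
Hypotheses (sAW : A \subset W) (a0A : a0 \in A).

Definition collapse (x : V) : V := if x \in A then a0 else x.
Definition collapse_arcs L := [seq (collapse e.1, collapse e.2) | e <- L].
Definition collapse_dem (x : V) : int := if x == a0 then sum_on b A else b x.
(** The vertices of A are merged into the representative a0, and the type of vertices
    is kept. *)
Definition contracted : {set V} := W :\: (A :\ a0).

Lemma a0_contracted : a0 \in contracted.
Proof. by rewrite !inE eqxx /= (subsetP sAW). Qed.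

Lemma contracted_sub x : x \in contracted -> (x \in W) && ((x == a0) || (x \notin A)).
Proof. by rewrite !inE negb_and negbK => /andP[-> ->]. Qed.

Lemma preim_out B : B \subset contracted -> a0 \notin B -> collapse @^-1: B = B.
Proof.
move=> sB a0B; apply/setP => x; rewrite !inE /collapse; case: ifP => // xA.
rewrite (negbTE a0B); apply/esym/negbTE/negP => xB.
have := contracted_sub (subsetP sB x xB); rewrite xA orbF => /andP[_ /eqP xa].
by rewrite -xa xB in a0B.
Qed.

Lemma preim_in B : B \subset contracted -> a0 \in B -> collapse @^-1: B = A :|: (B :\ a0).
Proof.
move=> sB a0B; apply/setP => x; rewrite !inE /collapse; case: ifP => //= xA.
by case: eqP xA => // ->; rewrite a0A.
Qed.

Lemma disjoint_rest B : B \subset contracted -> [disjoint A & B :\ a0].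
Proof.
move=> sB; rewrite disjoint_sym disjoints_subset; apply/subsetP => x.
rewrite !inE => /andP[nx xB].
by have := contracted_sub (subsetP sB x xB); rewrite (negbTE nx) => /andP[].
Qed.

Lemma sum_on_collapse B : B \subset contracted -> sum_on collapse_dem B = sum_on b (collapse @^-1: B).
Proof.
move=> sB; case: (boolP (a0 \in B)) => a0B.
  rewrite (preim_in sB a0B) sum_onU ?disjoint_rest // (sum_onD1 _ a0B).
  rewrite {1}/collapse_dem eqxx; congr (_ + _)%R; apply: eq_bigr => x.
  by rewrite !inE /collapse_dem => /andP[/negbTE ->].
rewrite (preim_out sB a0B); apply: eq_bigr => x xB; rewrite /collapse_dem.
by case: eqP => // xa; rewrite -xa xB in a0B.
Qed.

Lemma preim_full : collapse @^-1: contracted = W.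
Proof.
rewrite (preim_in (subxx _) a0_contracted); apply/setP => x; rewrite !inE.
case: (boolP (x \in A)) => [/(subsetP sAW) -> //|xA] /=.
by case: eqP => // xa; rewrite xa a0A in xA.
Qed.

Lemma preim_sub B : B \subset contracted -> collapse @^-1: B \subset W.
Proof. by move=> sB; rewrite -preim_full; apply: preimsetS. Qed.

Lemma preim_proper B : B \subset contracted -> B != contracted -> collapse @^-1: B != W.
Proof.
move=> sB; apply: contraNneq => eW; rewrite eqEsubset sB /=.
apply/subsetP => x xc; have := contracted_sub xc => /andP[xW h].
have: x \in collapse @^-1: B by rewrite eW.
rewrite inE /collapse; case: ifP => // xA; move: h; rewrite xA orbF.
by move/eqP ->.
Qed.

Lemma preim_mem x : x \in contracted ->
  collapse @^-1: [set x] = if x == a0 then A else [set x].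
Proof.
move=> xc; have sx : [set x] \subset contracted by rewrite sub1set.
case: eqP => [->|nx].
  rewrite preim_in ?inE ?eqxx ?sub1set ?a0_contracted //.
  by rewrite setDv setU0.
by rewrite preim_out // inE; apply/eqP => ?; apply: nx.
Qed.

Lemma collapse_in_W x : (collapse x \in contracted) = (x \in W).
Proof. by rewrite -[W in RHS]preim_full [RHS]in_set. Qed.

Lemma cut_size_collapse B : B \subset contracted ->
  cut_size (collapse_arcs (edges_off A E) ++ collapse_arcs Z) B = cut_size (E ++ Z) (collapse @^-1: B).
Proof.
move=> sB; rewrite !cut_size_cat !cut_size_map; congr (_ + _).
case: (boolP (a0 \in B)) => a0B.
  by rewrite (preim_in sB a0B) cut_size_edges_off // subsetUl.
rewrite (preim_out sB a0B); elim: E => [|e E' IH] //=.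
rewrite cut_size_cons -IH /inside.
have out x : x \in A -> x \notin B.
  move=> xA; apply/negP => xB; have := contracted_sub (subsetP sB x xB).
  by rewrite xA orbF => /andP[_ /eqP xa]; rewrite -xa xB in a0B.
case: (boolP (e.1 \in A)) => [/out /negbTE h1|?] /=; rewrite ?cut_size_cons //.
by case: (boolP (e.2 \in A)) => [/out /negbTE h2|?] /=; rewrite ?cut_size_cons // h1 h2.
Qed.

Lemma well_formed_contract : well_formed W E Z b ->
  well_formed contracted (collapse_arcs (edges_off A E)) (collapse_arcs Z) collapse_dem.
Proof.
move=> g; split.
- rewrite all_map; apply/allP => e; rewrite mem_filter /= !collapse_in_W => /andP[ne eE].
  have /and3P[-> -> e12] := allP (well_formed_free g) _ eE; rewrite /= /collapse.
  move: ne; rewrite /inside; case: ifP => h1; case: ifP => h2 //= _; apply/eqP.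
    by move=> a0e; rewrite -a0e a0A in h2.
  by move=> a0e; rewrite a0e a0A in h1.
- by rewrite all_map; apply: sub_all (well_formed_fixed g) => a /=; rewrite !collapse_in_W.
- move=> x xc; have sx : [set x] \subset contracted by rewrite sub1set.
  by rewrite -sum_on1 sum_on_collapse // cut_size_collapse //; apply: par_set (preim_sub sx).
by rewrite sum_on_collapse // outflow_map preim_full; exact: (well_formed_sum g).
Qed.

(** All cuts of the contracted instance are cuts of the original one, and a set
    that contains A is not the exceptional singleton. *)
Lemma admissible_contract v0 : 1 < #|A| -> admissible W E Z b v0 ->
  admissible contracted (collapse_arcs (edges_off A E)) (collapse_arcs Z) collapse_dem v0.
Proof.
move=> A2 g; split; first exact: (well_formed_contract g).
  by rewrite sum_on_collapse // cut_size_map preim_full; exact: (admissible_root g).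
move=> B sB B0 BW; rewrite sum_on_collapse // cut_size_collapse //.
have := admissible_cut g (preim_sub sB) _ (preim_proper sB BW).
case: (boolP (a0 \in B)) => a0B.
  rewrite preim_in // => /(_ _)/[dup] h.
  case: h => [|h|[e _]].
  - by apply/set0Pn; exists a0; rewrite !inE a0A.
  - by left.
  have: A \subset [set v0] by rewrite -e subsetUl.
  by move/subset_leq_card; rewrite cards1 leqNgt A2.
rewrite preim_out // => /(_ B0) [|[e e6]]; first by left.
right; split => //; rewrite /collapse_dem; case: eqP => // va.
by rewrite e va inE eqxx in a0B.
Qed.

Lemma card_contracted : #|contracted| + #|A| = #|W|.+1.
Proof.
rewrite cardsD (setIidPr (subset_trans (subsetDl _ _) sAW)).
have := subset_leq_card sAW; rewrite (cardsD1 a0 A) a0A; lia.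
Qed.

(** An orientation of the contracted graph is one of the edges not inside A. *)
Lemma contract_lift D1 : same_graph (collapse_arcs (edges_off A E)) D1 ->
  (forall x, x \in contracted ->
     (6 %| (outflow (D1 ++ collapse_arcs Z) [set x] - collapse_dem x)%R)%Z) ->
  exists D, [/\ same_graph (edges_off A E) D, perm_eq (collapse_arcs D) D1,
    (6 %| (sum_on b A - outflow (D ++ Z) A)%R)%Z &
    forall x, x \in W :\: A -> (6 %| (outflow (D ++ Z) [set x] - b x)%R)%Z].
Proof.
rewrite /same_graph /collapse_arcs -map_comp perm_sym => /perm_map_align [D2 p2 e2] h.
have [D sD eD] : exists2 D, map (@ends_of V) D = map (@ends_of V) (edges_off A E) &
    collapse_arcs D = D2.
  elim: (edges_off A E) D2 e2 {p2} => [|e E' IH] [|d D2] //=; first by exists [::].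
  case=> /ends_ofP ed /IH [D sD eD].
  case: ed => ->.
    by exists (e :: D); rewrite /= ?sD ?eD.
  by exists (rev_arc e :: D); rewrite /= ?ends_of_rev ?sD ?eD.
have {}p2 : perm_eq (collapse_arcs D) D1 by rewrite eD perm_sym.
have {}h x : x \in contracted -> (6 %| (outflow (D ++ Z) (collapse @^-1: [set x]) - collapse_dem x)%R)%Z.
  move=> /h; rewrite !outflow_cat outflow_map -(outflow_perm _ p2) outflow_map //.
exists D; split => //; first by rewrite /same_graph sD perm_refl.
  have := h _ a0_contracted; rewrite preim_mem ?a0_contracted // eqxx /collapse_dem eqxx; lia.
move=> x; rewrite inE => /andP[xA xW].
have xc : x \in contracted by rewrite !inE xW (negbTE xA) andbF.
have := h _ xc; rewrite preim_mem // /collapse_dem.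
by case: eqP => // xa; rewrite xa a0A in xA.
Qed.

End Contract.
End Moves.

(** * Lifting a pair of edges at a vertex *)

Section Lifts.
Variable V : finType.
Implicit Types (e a : V * V) (E F D Z L : seq (V * V)) (A B W : {set V}) (b : V -> int).

Definition weight W E Z := #|W| + size E + size Z.
(** The strengthening of the cut condition that holds for sets with at least two
    vertices in a minimal counterexample. *)
Definition slack W E Z b := forall A, A \subset W -> 1 < #|A| -> A != W ->
  6 + dist6 (sum_on b A) <= cut_size (E ++ Z) A.

Lemma cut_size_extend_self E Z A D : same_graph (edges_off A E) D ->
  cut_size (D ++ Z) A = cut_size (E ++ Z) A.
Proof.
move=> sD; rewrite -(cut_size_extend _ _ sD) [RHS]cut_size_cat (@cut_size_in _ (edges_in A E)) //.
by apply/allP => e; rewrite mem_filter => /andP[].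
Qed.

Lemma size_in_off A E : size (edges_in A E) + size (edges_off A E) = size E.
Proof. by rewrite !size_filter count_predC. Qed.

Lemma cut_size_avoid L v A B :
  all (fun e => (e.1 != v) && (e.2 != v)) L ->
  (forall u, u != v -> (u \in A) = (u \in B)) -> cut_size L A = cut_size L B.
Proof.
move=> + hAB; elim: L => [|a L IH] //= /andP[/andP[a1 a2] /IH].
by rewrite !cut_size_cons (hAB _ a1) (hAB _ a2) => ->.
Qed.

Lemma cut_size_star v ys A : v \notin ys ->
  cut_size (map (pair v) ys) A =
    if v \in A then count [predC A] ys else count [in A] ys.
Proof.
move=> _; rewrite /cut_size count_map; case: ifP => vA; apply: eq_count => y /=;
  by rewrite vA.
Qed.

Section Lifting.
Variables (W : {set V}) (b : V -> int) (v : V).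
Hypothesis vW : v \in W.

(** Replacing vx and vy by xy costs two edges only for cuts separating v from both x
    and y; slack pays for them, except for the singleton of v and, if x = y, that of x. *)
Lemma admissible_lift_free E Z x y v0 : x \in W -> y \in W -> x != v -> y != v ->
  let E0 := [:: (v, x), (v, y) & E] in
  well_formed W E0 Z b -> cut_size Z W <= 4 + dist6 (sum_on b W) ->
  (forall A, A \subset W -> A != set0 -> A != W -> A != [set v] ->
     4 + dist6 (sum_on b A) <= cut_size (E0 ++ Z) A) ->
  slack W E0 Z b ->
  (6 %| b v)%Z /\ v0 = v \/ 6 + dist6 (b v) <= cut_size (E0 ++ Z) [set v] ->
  (x = y -> 6 + dist6 (b x) <= cut_size (E0 ++ Z) [set x]) ->
  admissible W ((if x == y then [::] else [:: (x, y)]) ++ E) Z b v0.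
Proof.
move=> xW yW xv yv E0 g hroot h1 hs hv hx.
have crE A : cut_size (((if x == y then [::] else [:: (x, y)]) ++ E) ++ Z) A =
    ((x \in A) (+) (y \in A)) + cut_size (E ++ Z) A.
  rewrite -catA cut_size_cat; case: eqP => [->|_]; first by rewrite cut_size_nil addbb.
  by rewrite cut_size_cons cut_size_nil addn0.
have cr0 A : cut_size (E0 ++ Z) A = ((v \in A) (+) (x \in A)) + (((v \in A) (+) (y \in A)) + cut_size (E ++ Z) A).
  by rewrite /E0 /= !cut_size_cons.
split=> //; first split.
- have := well_formed_free g; rewrite /= all_cat => /andP[_ /andP[_ ->]]; rewrite andbT.
  by case: eqP => //= /eqP ->; rewrite xW yW.
- exact: well_formed_fixed g.
- move=> u uW; have := well_formed_par g uW; rewrite crE cr0.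
  by case: (v \in _); case: (x \in _); case: (y \in _) => /=; clear; lia.
- exact: well_formed_sum g.
move=> A sA A0 AW; have h1A := h1 A sA A0 AW; rewrite crE; rewrite cr0 in h1A.
case: (ltnP 1 #|A|) => [A2|A1].
  left; have := hs A sA A2 AW; rewrite cr0; clear.
  by case: (v \in A); case: (x \in A); case: (y \in A) => /=; lia.
have /cards1P [u Au] : #|A| == 1 by rewrite eqn_leq A1 card_gt0.
have mem z : (z \in A) = (z == u) by rewrite Au inE.
have bA : sum_on b A = b u by rewrite Au sum_on1.
case: (eqVneq u v) => [uv|nuv].
  subst u; case: hv => [[b6 ->]|]; first by right.
  rewrite bA cr0 -Au !mem eqxx (negbTE xv) (negbTE yv) => hd; left.
  by move: hd; clear; lia.
have /h1A : A != [set v] by rewrite Au (inj_eq (@set1_inj V)).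
rewrite bA !mem eq_sym (negbTE nuv) => {}h1A; left.
move: h1A hx; case: (x =P u) => xu; case: (y =P u) => yu /=.
- move=> _ /(_ (etrans xu (esym yu))).
  have -> : [set x] = A by rewrite xu Au.
  have -> : b x = b u by rewrite xu.
  by rewrite cr0 !mem xu yu eqxx eq_sym (negbTE nuv) /=; clear; lia.
- by move=> + _; clear; lia.
- by move=> + _; clear; lia.
by move=> + _; clear; lia.
Qed.

(** The same with a pre-oriented arc at v: its end v is moved to y, so the cut of W
    is unchanged. *)
Lemma admissible_lift_fixed E Z y (a : V * V) v0 : y \in W -> y != v ->
  (a.1 == v) || (a.2 == v) ->
  let a' := if a.1 == v then (y, a.2) else (a.1, y) in
  well_formed W ((v, y) :: E) (a :: Z) b -> cut_size (a :: Z) W <= 4 + dist6 (sum_on b W) ->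
  (forall A, A \subset W -> A != set0 -> A != W -> A != [set v] ->
     4 + dist6 (sum_on b A) <= cut_size (((v, y) :: E) ++ a :: Z) A) ->
  slack W ((v, y) :: E) (a :: Z) b ->
  (6 %| b v)%Z /\ v0 = v \/
    6 + dist6 (b v) <= cut_size (((v, y) :: E) ++ a :: Z) [set v] ->
  admissible W E (a' :: Z) b v0.
Proof.
move=> yW yv ha a' g hroot h1 hs hv.
have /= /andP[nfix fixZ] := well_formed_fixed g.
pose z := if a.1 == v then a.2 else a.1.
have zW : z \notin W.
  rewrite /z; case: eqP => [av|_] in ha *; first by rewrite av vW in nfix.
  by rewrite /= in ha; rewrite (eqP ha) vW andbT in nfix.
have cra A : ((a.1 \in A) (+) (a.2 \in A)) = ((z \in A) (+) (v \in A)).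
  by rewrite /z; case: eqP ha => [->|_ /= /eqP ->] //; rewrite addbC.
have cra' A : ((a'.1 \in A) (+) (a'.2 \in A)) = ((z \in A) (+) (y \in A)).
  by rewrite /z /a'; case: eqP => //=; rewrite addbC.
have crN A : cut_size (E ++ a' :: Z) A = ((z \in A) (+) (y \in A)) + cut_size (E ++ Z) A.
  by rewrite !cut_size_cat cut_size_cons cra' addnCA.
have cr0 A : cut_size (((v, y) :: E) ++ a :: Z) A =
    ((v \in A) (+) (y \in A)) + (((z \in A) (+) (v \in A)) + cut_size (E ++ Z) A).
  by rewrite cut_size_cat !cut_size_cons !cut_size_cat cra /= -!addnA (addnCA (cut_size E A)).
split; first split.
- by have := well_formed_free g => /= /andP[].
- rewrite /= fixZ andbT; move: nfix; rewrite /a' /z in zW *.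
  by case: eqP zW => /= _ /negbTE ->; rewrite ?andbF.
- move=> u uW; have := well_formed_par g uW; rewrite crN cr0.
  by case: (v \in _); case: (z \in _); case: (y \in _) => /=; clear; lia.
- have := well_formed_sum g; rewrite !outflow_cons /a' /z in zW *; move: zW.
  by case: eqP ha => [->|_ /= /eqP ->] _ /=; rewrite vW yW; clear; lia.
- move: hroot; by rewrite !cut_size_cons cra cra' vW yW.
move=> A sA A0 AW; have h1A := h1 A sA A0 AW; rewrite crN; rewrite cr0 in h1A.
have zA : (z \in A) = false by apply: contraNF zW; apply: (subsetP sA).
case: (ltnP 1 #|A|) => [A2|A1].
  left; have := hs A sA A2 AW; rewrite cr0; clear.
  by case: (v \in A); case: (z \in A); case: (y \in A) => /=; lia.
have /cards1P [u Au] : #|A| == 1 by rewrite eqn_leq A1 card_gt0.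
have mem w : (w \in A) = (w == u) by rewrite Au inE.
have bA : sum_on b A = b u by rewrite Au sum_on1.
case: (eqVneq u v) => [uv|nuv].
  subst u; case: hv => [[b6 ->]|]; first by right.
  rewrite bA cr0 -Au zA !mem eqxx (negbTE yv) => hd; left.
  by move: hd; clear; lia.
have /h1A : A != [set v] by rewrite Au (inj_eq (@set1_inj V)).
rewrite bA zA !mem (eq_sym v) (negbTE nuv) /= => {}h1A; left.
by move: h1A; clear; lia.
Qed.

End Lifting.
End Lifts.

(** * Tight sets and the existence of liftings *)

Section Induction.
Variable V : finType.
Implicit Types (e a : V * V) (E F D Z L : seq (V * V)) (A B W : {set V}) (b : V -> int).

(** Induction hypothesis.  Contraction, restriction, lifting and deletion of an
    arc all decrease the weight. *)
Definition solves_below W E Z := forall W' E' Z' b v0,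
  weight W' E' Z' < weight W E Z -> admissible W' E' Z' b v0 -> solvable W' E' Z' b.

Lemma size_extend A E D Z : same_graph (edges_off A E) D ->
  size (edges_in A E) + size (D ++ Z) = size E + size Z.
Proof. by move=> /same_graph_size sD; rewrite size_cat -sD addnA size_in_off. Qed.

Lemma size_collapse A (r : V) L : size (collapse_arcs A r L) = size L.
Proof. exact: size_map. Qed.

Lemma weight_contract W A (r : V) E Z : A \subset W -> r \in A -> 1 < #|A| ->
  weight (contracted W A r) (collapse_arcs A r (edges_off A E)) (collapse_arcs A r Z)
    < weight W E Z.
Proof.
move=> sA aA A2; rewrite /weight !size_collapse.
have := card_contracted sA aA; have := size_in_off A E.
move: A2; clear; lia.
Qed.

(** A set with d(A) = 4 + |tau(A)| meets the bound required of a root.  Hence after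
    solving the instance in which A is contracted, the orientation extends into A. *)
Lemma solve_tight W E Z b v0 A : solves_below W E Z ->
  admissible W E Z b v0 -> A \subset W -> 1 < #|A| -> A != W ->
  cut_size (E ++ Z) A < 6 + dist6 (sum_on b A) -> solvable W E Z b.
Proof.
move=> IH g sA A2 AW hlt.
have [r aA] : exists r, r \in A by apply/set0Pn; rewrite -card_gt0 ltnW.
have hd : cut_size (E ++ Z) A <= 4 + dist6 (sum_on b A).
  have [|cutA|[Av _]] := admissible_cut g sA _ AW; first by apply/set0Pn; exists r.
    have := par_set g sA; rewrite /dist6 in hlt *; move: hlt; clear; lia.
  by rewrite Av cards1 in A2.
have [D1 s1 h1] := IH _ _ _ _ _ (weight_contract E Z sA aA A2) (admissible_contract sA aA A2 g).
have [D [sD _ hA hout]] := contract_lift sA aA s1 h1.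
apply: (glue sA sD hout); apply: (IH _ _ _ _ v0).
  rewrite /weight -!addnA (size_extend _ sD) ltn_add2r; apply: proper_card.
  by rewrite properEneq AW.
split; first exact: well_formed_extend g sA sD hA.
  by rewrite (cut_size_extend_self _ sD).
move=> B sB B0 BA; rewrite (cut_size_extend _ _ sD).
apply: (admissible_cut g) => //; first exact: subset_trans sB sA.
apply: contraNneq AW => BW; rewrite eqEsubset sA -{1}BW; exact: sB.
Qed.

Lemma size_perm_cons E a E' : perm_eq E (a :: E') -> size E = (size E').+1.
Proof. by move/perm_size. Qed.

Lemma all_incident_fixed Z v :
  ~~ has (fun a => (a.1 == v) || (a.2 == v)) Z ->
  all (fun a => (a.1 != v) && (a.2 != v)) Z.
Proof. by rewrite -all_predC; apply: sub_all => a /=; rewrite negb_or. Qed.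

(** Besides solving the instance, lifting produces an arc leaving v: the two
    lifted edges pass through v in the direction given to the edge that replaced them. *)
Lemma lift_at W E Z b v : v \in W -> solves_below W E Z -> well_formed W E Z b ->
  cut_size Z W <= 4 + dist6 (sum_on b W) ->
  (forall A, A \subset W -> A != set0 -> A != W -> A != [set v] ->
     4 + dist6 (sum_on b A) <= cut_size (E ++ Z) A) ->
  slack W E Z b ->
  (6 %| b v)%Z \/ 6 + dist6 (b v) <= cut_size (E ++ Z) [set v] ->
  0 < cut_size E [set v] -> 1 < cut_size (E ++ Z) [set v] ->
  (forall x, x \in W -> x != v ->
     cut_size (E ++ Z) [set v; x] + cut_size (E ++ Z) [set v] = cut_size (E ++ Z) [set x] ->
     6 + dist6 (b x) <= cut_size (E ++ Z) [set x]) ->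
  exists D, [/\ same_graph E D,
    forall x, x \in W -> (6 %| (outflow (D ++ Z) [set x] - b x)%R)%Z &
    exists2 a, a \in D ++ Z & (a.1 == v) && (a.2 != v)].
Proof.
move=> vW IH g hroot h1 hs hv hE h2 hx.
have [|ys [E' [sE vys hE']]] := @star_decomposition _ E v.
  by apply: sub_all (well_formed_free g) => e /and3P[].
have szE : size E = size ys + size E' by rewrite (same_graph_size sE) size_cat size_map.
have g2 := well_formed_same sE (perm_refl Z) g.
have ysW : all (fun y => (y \in W) && (y != v)) ys.
  have := well_formed_free g2; rewrite all_cat => /andP[+ _]; rewrite all_map.
  by apply: sub_all => y /= /and3P[_ -> nv]; rewrite eq_sym.
have crE'v L : all (fun e => (e.1 != v) && (e.2 != v)) L -> cut_size L [set v] = 0.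
  by move=> hL; apply: cut_size_out; apply: sub_all hL => e; rewrite !inE.
have crEv : cut_size E [set v] = size ys.
  rewrite (cut_size_same _ sE) cut_size_cat (crE'v _ hE') addn0 cut_size_star // inE eqxx.
  by apply/eqP; rewrite -all_count; apply: sub_all ysW => y /=; rewrite !inE => /andP[].
rewrite crEv in hE.
have transport F F' : same_graph E F -> cut_size (E ++ F') =1 cut_size (F ++ F').
  by move=> s A; rewrite !cut_size_cat (cut_size_same _ s).
case: (boolP (has (fun a => (a.1 == v) || (a.2 == v)) Z)) => hZ.
  have /hasP[a aZ av] := hZ.
  have pZ : perm_eq Z (a :: rem a Z) by apply: perm_to_rem.
  case: ys => [|y ys] in sE vys szE ysW hE crEv g2 *; first by [].
  case/andP: ysW => /andP[yW yv] _.
  set E1 := map (pair v) ys ++ E' in sE.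
  have {}sE : same_graph E ((v, y) :: E1) by exact: sE.
  have crT A : cut_size (((v, y) :: E1) ++ a :: rem a Z) A = cut_size (E ++ Z) A.
    by rewrite !cut_size_cat -(cut_size_same _ sE) -(cut_size_perm _ pZ).
  have gl : admissible W E1 ((if a.1 == v then (y, a.2) else (a.1, y)) :: rem a Z) b v.
    apply: (admissible_lift_fixed vW yW yv av).
    - exact: well_formed_same sE pZ g.
    - by rewrite -(cut_size_perm _ pZ).
    - by move=> A; rewrite crT; apply: h1.
    - by move=> A; rewrite crT; apply: hs.
    - by rewrite crT; case: hv; [left|right].
  have [|D sD hD] := IH _ _ _ _ _ _ gl.
    rewrite /weight (same_graph_size sE) (size_perm_cons pZ) /=; clear; lia.
  have nfix : ~~ ((a.1 \in W) && (a.2 \in W)) by apply: (allP (well_formed_fixed g)).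
  case: (boolP (a.1 == v)) => a1 in hD gl *.
    have nv2 : a.2 != v by apply: contraNneq nfix => ->; rewrite (eqP a1) vW.
    exists ((y, v) :: D); split.
    - apply: (same_graph_trans sE); exact: (@same_graph_rev _ (v, y)).
    - move=> x /hD; rewrite !outflow_cat (outflow_perm _ pZ) !outflow_cons /= (eqP a1).
      by clear; lia.
    by exists a; rewrite ?a1 ?nv2 // mem_cat aZ orbT.
  have a2 : a.2 == v by rewrite (negbTE a1) in av.
  exists ((v, y) :: D); split.
  - by apply: (same_graph_trans sE); exact: same_graph_cons.
  - move=> x /hD; rewrite !outflow_cat (outflow_perm _ pZ) !outflow_cons /= (eqP a2).
    by clear; lia.
  by exists (v, y); rewrite ?mem_head //= eqxx yv.
have {}hZ := all_incident_fixed hZ.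
have [x [y [ys' [pys xy]]]] : exists x y ys', perm_eq ys [:: x, y & ys'] /\
    (x = y -> all (pred1 x) ys).
  have : 1 < size ys by rewrite -crEv; move: h2; rewrite cut_size_cat (crE'v _ hZ) addn0.
  case: ys {sE vys szE ysW hE crEv g2} => [|x [|y0 ys]] // _.
  case: (boolP (all (pred1 x) (y0 :: ys))) => [hall|/allPn[y yys nyx]].
    by exists x, y0, ys; split; rewrite ?perm_refl //= eqxx.
  exists x, y, (rem y (y0 :: ys)); split; last by move=> xy; rewrite /= xy eqxx in nyx.
  by rewrite perm_cons perm_to_rem.
have := perm_all (fun y => (y \in W) && (y != v)) pys; rewrite ysW /=.
move/esym/and3P => [/andP[xW xv] /andP[yW yv] _].
set E1 := map (pair v) ys' ++ E'.
have sE0 := sE; have {sE} sE : same_graph E [:: (v, x), (v, y) & E1].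
  apply: (same_graph_trans sE); apply: same_graph_perm.
  by rewrite -[[:: _, _ & E1]]/(map (pair v) [:: x, y & ys'] ++ E') perm_cat2r perm_map.
have crT A : cut_size ([:: (v, x), (v, y) & E1] ++ Z) A = cut_size (E ++ Z) A.
  by rewrite !cut_size_cat -(cut_size_same _ sE).
have gl : admissible W ((if x == y then [::] else [:: (x, y)]) ++ E1) Z b v.
  apply: (@admissible_lift_free _ W b v) => //.
  - exact: well_formed_same sE (perm_refl _) g.
  - by move=> A; rewrite crT; apply: h1.
  - by move=> A; rewrite crT; apply: hs.
  - by rewrite crT; case: hv; [left|right].
  move=> /xy hall; rewrite crT; apply: hx => //.
  have ysx : ys = nseq (size ys) x by apply/all_pred1P.
  rewrite !cut_size_cat crEv (crE'v _ hZ).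
  (* All edges of v lead to x, so the pair {v, x} has d(x) - d(v) boundary edges. *)
  have av L : all (fun e => (e.1 != v) && (e.2 != v)) L -> cut_size L [set v; x] = cut_size L [set x].
    by move=> hL; apply: cut_size_avoid hL _ => u nuv; rewrite !inE (negbTE nuv).
  rewrite (av _ hZ).
  suff : cut_size E [set v; x] + size ys = cut_size E [set x] by clear; lia.
  rewrite !(cut_size_same _ sE0) !cut_size_cat (av _ hE') {1 3}ysx map_nseq !cut_size_nseq.
  by rewrite !inE /= !eqxx (eq_sym v) (negbTE xv) /=; clear; lia.
have [|D sD hD] := IH _ _ _ _ _ _ gl.
  rewrite /weight (same_graph_size sE); case: eqP => _ /=; clear; lia.
case: (boolP (x == y)) => exy in sD gl *.
  exists [:: (v, x), (y, v) & D]; split.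
  - apply: (same_graph_trans sE); apply: same_graph_cons; exact: (@same_graph_rev _ (v, y)).
  - by move=> z /hD; rewrite !outflow_cat !outflow_cons /= (eqP exy); clear; lia.
  by exists (v, x); rewrite ?mem_head //= eqxx.
have [a [D' [pD ha sD']]] := same_graph_consP sD.
case: ha => ea.
  exists [:: (x, v), (v, y) & D']; split.
  - by apply: (same_graph_trans sE); apply: (@same_graph_rev _ (v, x)); apply: same_graph_cons.
  - move=> z /hD; rewrite !outflow_cat (outflow_perm _ pD) ea !outflow_cons /=; clear; lia.
  by exists (v, y); rewrite ?inE ?eqxx ?orbT //= eqxx.
exists [:: (v, x), (y, v) & D']; split.
- by apply: (same_graph_trans sE); apply: same_graph_cons; apply: (@same_graph_rev _ (v, y)).
- move=> z /hD; rewrite !outflow_cat (outflow_perm _ pD) ea !outflow_cons /=; clear; lia.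
by exists (v, x); rewrite ?mem_head //= eqxx.
Qed.

End Induction.

(** * Vertices of boundary zero and deletable edges *)

Section Deletions.
Variable V : finType.
Implicit Types (e a : V * V) (E F D Z L : seq (V * V)) (A B W : {set V}) (b : V -> int).

Lemma cut_size_subadd L A B : cut_size L (A :|: B) <= cut_size L A + cut_size L B.
Proof.
elim: L => [|[u v] L]; rewrite ?cut_size_nil // !cut_size_cons !inE /=.
by case: (u \in A); case: (v \in A); case: (u \in B); case: (v \in B) => /=; clear; lia.
Qed.

Lemma cut_size_setD L A B : cut_size L (A :\: B) <= cut_size L A + cut_size L B.
Proof.
elim: L => [|[u v] L]; rewrite ?cut_size_nil // !cut_size_cons !inE /=.
by case: (u \in A); case: (v \in A); case: (u \in B); case: (v \in B) => /=; clear; lia.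
Qed.

(** The cut condition without an exceptional vertex. *)
Definition firm W E Z b := forall A, A \subset W -> A != set0 -> A != W ->
  4 + dist6 (sum_on b A) <= cut_size (E ++ Z) A.

Lemma cut_size_free_W W E Z b : well_formed W E Z b -> cut_size E W = 0.
Proof.
by move=> g; apply: cut_size_in; apply: sub_all (well_formed_free g) => e /and3P[-> ->].
Qed.

Lemma crZ_setD W E Z b A : well_formed W E Z b -> A \subset W ->
  cut_size Z W = cut_size Z A + cut_size Z (W :\: A).
Proof.
move=> g sA; have eW : A :|: (W :\: A) = W by rewrite -{2}(setID W A) (setIidPr sA).
rewrite -{1}eW; apply: (cut_size_fixedU (well_formed_fixed g)); last by rewrite eW.
by rewrite disjoint_sym disjoints_subset subsetDr.
Qed.

Lemma crZ_D1 W E Z b x : well_formed W E Z b -> x \in W ->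
  cut_size Z W = cut_size Z [set x] + cut_size Z (W :\ x).
Proof. by move=> g xW; apply: crZ_setD g _; rewrite sub1set. Qed.

Lemma crE_D1 W E Z b x : well_formed W E Z b -> x \in W -> cut_size E (W :\ x) = cut_size E [set x].
Proof.
move=> g xW; have := well_formed_free g; elim: E {g} => [|[u v] E IH] //=.
rewrite !cut_size_cons => /andP[/and3P[/= uW vW _] /IH ->].
by rewrite !inE uW vW !andbT; case: (u == x); case: (v == x).
Qed.

(** The balance at x determines the boundary condition of the instance in which x
    belongs to the root. *)
Lemma absorb_sum W E Z b x D : well_formed W E Z b -> x \in W ->
  same_graph (edges_off (W :\ x) E) D -> (6 %| (outflow (D ++ Z) [set x] - b x)%R)%Z ->
  (6 %| (sum_on b (W :\ x) - outflow (D ++ Z) (W :\ x))%R)%Z.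
Proof.
move=> g xW sD; have := well_formed_sum g; rewrite !outflow_cat (sum_onD1 b xW).
have : outflow D W = 0%R.
  apply: outflow_in.
  rewrite -(same_graph_all (P := fun e => (e.1 \in W) && (e.2 \in W)) _ sD); last first.
    by move=> a /=; rewrite andbC.
  apply/allP => e; rewrite mem_filter => /andP[_ /(allP (well_formed_free g))].
  by case/and3P => -> ->.
rewrite (outflowD1 D xW) (outflowD1 Z xW); clear; lia.
Qed.

Lemma size_absorb W x E Z D : x \in W -> same_graph (edges_off (W :\ x) E) D ->
  weight (W :\ x) (edges_in (W :\ x) E) (D ++ Z) < weight W E Z.
Proof.
move=> xW sD; rewrite /weight -!addnA (size_extend _ sD) ltn_add2r.
by rewrite [in X in _ < X](cardsD1 x) xW.
Qed.

(** A vertex of degree and boundary zero can be moved to the root. *)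
Lemma solve_isolated W E Z b v : solves_below W E Z -> well_formed W E Z b ->
  cut_size Z W <= 4 + dist6 (sum_on b W) ->
  (forall A, A \subset W -> A != set0 -> A != W -> A != [set v] ->
     4 + dist6 (sum_on b A) <= cut_size (E ++ Z) A) ->
  v \in W -> (6 %| b v)%Z -> cut_size (E ++ Z) [set v] = 0 -> solvable W E Z b.
Proof.
move=> IH g hroot h1 vW b6 d0; set A := W :\ v.
have sA : A \subset W by apply: subD1set.
pose D := edges_off A E; have sD : same_graph (edges_off A E) D by apply: same_graph_refl.
have crD : cut_size (D ++ Z) [set v] = 0.
  apply/eqP; rewrite -leqn0 -d0 !cut_size_cat leq_add2r.
  by rewrite [X in _ <= X](cut_size_same _ (same_graph_split A E)) cut_size_cat leq_addl.
have nD : outflow (D ++ Z) [set v] = 0%R.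
  by have := abs_net_le (D ++ Z) [set v]; rewrite crD; clear; lia.
have hv : (6 %| (outflow (D ++ Z) [set v] - b v)%R)%Z by rewrite nD; move: b6; clear; lia.
have hA := absorb_sum g vW sD hv.
apply: (glue sA sD).
  by move=> x; rewrite !inE negb_and negbK => /andP[/orP[/eqP ->|/negbTE ->]].
apply: (IH _ _ _ _ v); first exact: size_absorb.
split; first exact: (well_formed_extend g sA sD hA).
  rewrite (cut_size_extend_self _ sD) (@dist6_eq _ (sum_on b W)); last first.
    by rewrite (sum_onD1 b vW) -/A; move: b6; clear; lia.
  apply: leq_trans hroot; apply: leq_trans (cut_size_setD _ _ _) _.
  by rewrite d0 addn0 cut_size_cat (cut_size_free_W g).
move=> B sB B0 BA; rewrite (cut_size_extend _ _ sD); left; apply: h1 => //.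
- exact: subset_trans sB sA.
- by apply: contraTneq vW => BW; move: sB; rewrite BW subsetD1 => /andP[].
by apply: contraTneq sB => ->; rewrite sub1set !inE eqxx.
Qed.

(** A vertex of boundary zero, made exceptional, loses its edges by liftings until
    it is isolated. *)
Lemma solve_zero W E Z b v0 v : solves_below W E Z -> admissible W E Z b v0 ->
  2 < #|W| -> slack W E Z b -> v \in W -> (6 %| b v)%Z -> solvable W E Z b.
Proof.
move=> IH g W3 hs vW b6.
(* If there already is an exceptional vertex, it must be treated first. *)
have [w [wW {}b6 h1]] : exists w, [/\ w \in W, (6 %| b w)%Z &
  forall A, A \subset W -> A != set0 -> A != W -> A != [set w] ->
     4 + dist6 (sum_on b A) <= cut_size (E ++ Z) A].
  case: (boolP ((v0 \in W) && (6 %| b v0)%Z)) => [/andP[v0W b0]|hv0].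
    exists v0; split => // A sA A0 AW nA.
    by case: (admissible_cut g sA A0 AW) => // -[eA]; rewrite eA eqxx in nA.
  exists v; split => // A sA A0 AW nA.
  case: (admissible_cut g sA A0 AW) => // -[eA b0]; case/negP: hv0.
  by rewrite b0 andbT -sub1set -eA.
have hroot := admissible_root g.
case: (posnP (cut_size (E ++ Z) [set w])) => d0; first exact: (solve_isolated IH g hroot h1 wW b6 d0).
have d2 : 1 < cut_size (E ++ Z) [set w].
  by have := well_formed_par g wW; move: d0 b6; clear; lia.
have cardA : #|W :\ w| = #|W|.-1 by rewrite [in RHS](cardsD1 w) wW.
have hE : 0 < cut_size E [set w].
  rewrite lt0n; apply/negP => /eqP E0.
  have := h1 (W :\ w) (subD1set _ _) _ _ _.
  rewrite cut_size_cat (crE_D1 g wW) E0 (@dist6_eq _ (sum_on b W)); last first.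
    by rewrite (sum_onD1 b wW); move: b6; clear; lia.
  have := crZ_D1 g wW; move: d0; rewrite cut_size_cat E0 => d0 ez h.
  have : 4 + dist6 (sum_on b W) <= 0 + cut_size Z (W :\ w).
    apply: h.
    - by rewrite -card_gt0 cardA; move: W3; clear; lia.
    - by apply: contraTneq wW => <-; rewrite !inE eqxx.
    by apply/eqP => e; have := cardA; rewrite e cards1; move: W3; clear; lia.
  by move: hroot ez d0; clear; lia.
have [|D [sD hD _]] := lift_at wW IH g hroot h1 hs (or_introl b6) hE d2; last by exists D.
move=> x xW nxw hx.
have := h1 [set w; x] _ _ _ _; rewrite subUset !sub1set wW xW => /(_ isT).
have dwx : [disjoint [set w] & [set x]] by rewrite disjoints1 inE eq_sym.
rewrite (sum_onU _ dwx) !sum_on1 (@dist6_eq _ (b x)); last first.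
  by move: b6; clear; lia.
have c2 : #|[set w; x]| = 2 by rewrite cards2 eq_sym nxw.
have n0 : [set w; x] != set0 by rewrite -card_gt0 c2.
have nW : [set w; x] != W by apply: contraTneq W3 => <-; rewrite c2.
have n1 : [set w; x] != [set w] by apply/eqP => e; move: c2; rewrite e cards1.
by move=> /(_ n0 nW n1); move: hx d2; clear; lia.
Qed.

Lemma outflow_arc_bound a A : `|outflow [:: a] A|%N = ((a.1 \in A) (+) (a.2 \in A)).
Proof. by rewrite outflow_arc; case: (_ \in A); case: (_ \in A). Qed.

(** Deleting an oriented edge lowers d by one and changes |tau| by one.  Slack
    absorbs this for larger sets, so only the two ends have to be examined. *)
Lemma drop_cut W (E0 Z0 E Z : seq (V * V)) b a : 
  (forall A, cut_size (E0 ++ Z0) A = ((a.1 \in A) (+) (a.2 \in A)) + cut_size (E ++ Z) A) ->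
  firm W E0 Z0 b -> slack W E0 Z0 b ->
  (forall x, x \in W -> (a.1 == x) || (a.2 == x) ->
     5 + dist6 (demand_after b a x) <= cut_size (E0 ++ Z0) [set x]) ->
  firm W E Z (demand_after b a).
Proof.
move=> eqc h1 hs hx A sA A0 AW.
have := h1 A sA A0 AW; have := outflow_arc_bound a A; rewrite sum_on_demand_after eqc.
case cross : ((a.1 \in A) (+) (a.2 \in A)) => /= hn h; last first.
  have -> : outflow [:: a] A = 0%R by move: hn; clear; lia.
  by rewrite subr0.
case: (ltnP 1 #|A|) => [A2|A1].
  have := hs A sA A2 AW; rewrite eqc cross /=.
  have := @dist6_le_succ (sum_on b A - outflow [:: a] A)%R (sum_on b A).
  move: hn; clear; move: (outflow _ _) (dist6 _) (dist6 _) => n d1 d2; clear; lia.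
have /cards1P [u Au] : #|A| == 1 by rewrite eqn_leq A1 card_gt0.
have uW : u \in W by rewrite -sub1set -Au.
have := hx u uW _; rewrite -Au eqc cross -sum_on1 sum_on_demand_after -Au => /(_ _) H.
rewrite -ltnS -addSn -[(cut_size _ _).+1]add1n; apply: H.
by move: cross; rewrite Au !inE; case: (a.1 == u).
Qed.

Lemma admissible_drop_fixed W E Z b v0 a : well_formed W E (a :: Z) b ->
  cut_size (a :: Z) W <= 4 + dist6 (sum_on b W) -> (a.1 \in W) || (a.2 \in W) ->
  firm W E (a :: Z) b -> slack W E (a :: Z) b ->
  (forall x, x \in W -> (a.1 == x) || (a.2 == x) ->
     5 + dist6 (demand_after b a x) <= cut_size (E ++ a :: Z) [set x]) ->
  admissible W E Z (demand_after b a) v0.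
Proof.
move=> g hroot aW h1 hs hx; split; first exact: well_formed_drop.
  have /= /andP[na _] := well_formed_fixed g; move: hroot; rewrite cut_size_cons sum_on_demand_after.
  have cross : (a.1 \in W) (+) (a.2 \in W) by case: (_ \in W) na aW; case: (_ \in W).
  have := outflow_arc_bound a W; rewrite cross /=.
  have := @dist6_le_succ (sum_on b W) (sum_on b W - outflow [:: a] W)%R.
  move: (outflow _ _) (dist6 _) (dist6 _) => n d1 d2; clear; lia.
move=> A sA A0 AW; left; move: A sA A0 AW; apply: drop_cut h1 hs hx => A.
by rewrite !cut_size_cat cut_size_cons addnCA.
Qed.

Lemma admissible_drop_free W E Z b v0 a : well_formed W (a :: E) Z b ->
  cut_size Z W <= 4 + dist6 (sum_on b W) ->
  firm W (a :: E) Z b -> slack W (a :: E) Z b ->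
  (forall x, x \in W -> (a.1 == x) || (a.2 == x) ->
     5 + dist6 (demand_after b a x) <= cut_size ((a :: E) ++ Z) [set x]) ->
  admissible W E Z (demand_after b a) v0.
Proof.
move=> g hroot h1 hs hx; split; first exact: well_formed_direct.
  have /= /andP[/and3P[a1 a2 _] _] := well_formed_free g.
  by rewrite sum_on_demand_after outflow_arc a1 a2 subrr subr0.
move=> A sA A0 AW; left; move: A sA A0 AW; apply: drop_cut h1 hs hx => A.
by rewrite /= cut_size_cons.
Qed.

(** The vertex satisfies the cut condition after the deletion of an arc leaving it;
    can_in is the same for entering arcs. *)
Definition can_out E Z b x := 5 + dist6 (b x - 1)%R <= cut_size (E ++ Z) [set x].
Definition can_in E Z b x := 5 + dist6 (b x + 1)%R <= cut_size (E ++ Z) [set x].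

Lemma firm_same W E F Z Z' b : same_graph E F -> perm_eq Z Z' -> firm W E Z b -> firm W F Z' b.
Proof.
by move=> s p h A; rewrite cut_size_cat -(cut_size_same _ s) -(cut_size_perm _ p) -cut_size_cat; apply: h.
Qed.

Lemma slack_same W E F Z Z' b : same_graph E F -> perm_eq Z Z' -> slack W E Z b -> slack W F Z' b.
Proof.
by move=> s p h A; rewrite cut_size_cat -(cut_size_same _ s) -(cut_size_perm _ p) -cut_size_cat; apply: h.
Qed.

Lemma mem_same_cons e e' E : e \in E -> e = e' \/ e = rev_arc e' ->
  exists2 E', same_graph E (e' :: E') & size E = (size E').+1.
Proof.
move=> eE h; exists (rem e E); last by rewrite (perm_size (perm_to_rem eE)).
apply: (same_graph_trans (same_graph_perm (perm_to_rem eE))).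
case: h => [<-|->]; first exact: same_graph_refl.
by rewrite same_graph_sym; apply: same_graph_rev; apply: same_graph_refl.
Qed.

Lemma solve_free W E Z b v0 e x y : solves_below W E Z ->
  admissible W E Z b v0 -> firm W E Z b -> slack W E Z b ->
  e \in E -> e = (x, y) \/ e = (y, x) ->
  can_out E Z b x -> can_in E Z b y -> solvable W E Z b.
Proof.
move=> IH g h1 hs eE exy hx hy.
have [E' sE szE] := mem_same_cons eE (exy : e = (x, y) \/ e = rev_arc (x, y)).
have nxy : x != y.
  have := allP (well_formed_free g) _ eE.
  by case: exy => -> /and3P[_ _] //=; rewrite eq_sym.
apply: (solvable_same sE); apply: solvable_direct.
apply: (IH _ _ _ _ v0); first by rewrite /weight szE; clear; lia.
apply: admissible_drop_free.
- exact: well_formed_same sE (perm_refl _) g.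
- exact: admissible_root g.
- exact: firm_same sE (perm_refl _) h1.
- exact: slack_same sE (perm_refl _) hs.
move=> z _; rewrite cut_size_cat -(cut_size_same _ sE) -cut_size_cat demand_afterE /=.
case/orP => /eqP <-; rewrite eqxx ?(eq_sym y) (negbTE nxy).
  by rewrite subr0; exact: hx.
by rewrite sub0r opprK; exact: hy.
Qed.

Lemma solve_fixed W E Z b v0 a : solves_below W E Z ->
  admissible W E Z b v0 -> firm W E Z b -> slack W E Z b -> a \in Z ->
  (a.1 \in W) && can_out E Z b a.1 || (a.2 \in W) && can_in E Z b a.2 ->
  solvable W E Z b.
Proof.
move=> IH g h1 hs aZ ha; have pZ := perm_to_rem aZ.
apply: (solvable_perm pZ); apply: solvable_drop.
have nfix := allP (well_formed_fixed g) _ aZ.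
apply: (IH _ _ _ _ v0).
  by rewrite /weight [X in _ < _ + X](perm_size pZ) /=; clear; lia.
apply: admissible_drop_fixed.
- exact: well_formed_same (same_graph_refl _) pZ g.
- by rewrite -(cut_size_perm _ pZ); exact: admissible_root g.
- by case/orP: ha => /andP[-> _]; rewrite ?orbT.
- exact: firm_same (same_graph_refl _) pZ h1.
- exact: slack_same (same_graph_refl _) pZ hs.
move=> z zW; rewrite cut_size_cat -(cut_size_perm _ pZ) -cut_size_cat demand_afterE.
case/orP: ha => /andP[aW ha]; rewrite aW ?andbT /= in nfix;
  case/orP => /eqP az; rewrite -?az ?aW in zW nfix *.
- have /negbTE-> : a.2 != a.1 by apply: contraNneq nfix => ->.
  by rewrite eqxx subr0.
- by rewrite zW in nfix.
- by rewrite zW in nfix.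
have /negbTE-> : a.1 != a.2 by apply: contraNneq nfix => ->.
by rewrite eqxx sub0r opprK.
Qed.

(** W is connected by free edges: a set without free edges in its boundary, and its
    complement, would have at least 4 pre-oriented arcs each, but there are at most 7. *)
Lemma free_crossing W E Z b v0 A : admissible W E Z b v0 -> firm W E Z b ->
  A \subset W -> A != set0 -> A != W ->
  exists2 e, e \in E & (e.1 \in A) (+) (e.2 \in A).
Proof.
move=> g h1 sA A0 AW.
case: (boolP (has (fun e => (e.1 \in A) (+) (e.2 \in A)) E)) => [/hasP //|].
rewrite has_count -leqNgt leqn0 -[count _ _]/(cut_size E A) => /eqP cA.
have B0 : W :\: A != set0.
  by rewrite setD_eq0; apply: contraNN AW => sW; rewrite eqEsubset sA.
have BW : W :\: A != W.
  apply: contraNneq A0 => e; rewrite -subset0; apply/subsetP => x xA.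
  by have := subsetP sA x xA; rewrite -e inE xA.
have := h1 _ (subsetDl _ _) B0 BW; have := h1 A sA A0 AW.
have := cut_size_setD E W A; rewrite (cut_size_free_W g) cA leqn0 => /eqP cB.
have := crZ_setD g sA.
rewrite !cut_size_cat cA cB; have := admissible_root g.
rewrite /dist6; clear; lia.
Qed.

End Deletions.

(** * The case where all boundaries have the same sign *)

Section Positive.
Variable V : finType.
Implicit Types (e a : V * V) (E F D Z L : seq (V * V)) (A B W : {set V}) (b : V -> int).

(** The structure of a minimal counterexample once every vertex can lose an
    outgoing arc: boundaries 1 or 2, degrees 5 or 6, and all arcs of the root enter W. *)
Record positive W E Z b v0 : Prop := Positive {
  pos_good :> admissible W E Z b v0;
  pos_firm : firm W E Z b;
  pos_slack : slack W E Z b;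
  pos_deg : forall x, x \in W -> exists2 t, 0 < t <= 2 &
     (6 %| (b x - t%:Z)%R)%Z /\ cut_size (E ++ Z) [set x] = 4 + t;
  pos_enter : forall a, a \in Z -> a.1 \notin W }.

Lemma pos_can_out W E Z b v0 x : positive W E Z b v0 -> x \in W -> can_out E Z b x.
Proof.
move=> p /(pos_deg p) [t ht [hb hc]]; rewrite /can_out hc.
by move: ht hb; rewrite /dist6; clear; lia.
Qed.

Lemma outflow_enter W Z A : (forall a, a \in Z -> a.1 \notin W) -> A \subset W ->
  outflow Z A = (- (cut_size Z A)%:Z)%R.
Proof.
move=> + sA; elim: Z => [|a Z IH] h; first by rewrite outflow_nil cut_size_nil.
rewrite outflow_cons cut_size_cons IH; last by move=> c cZ; apply: h; rewrite inE cZ orbT.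
have /negbTE -> : a.1 \notin A by apply: contra (h a (mem_head _ _)); apply: (subsetP sA).
by case: (a.2 \in A) => /=; clear; lia.
Qed.

(** When all k arcs leave the root, its boundary is k, so k <= 4 + |tau| forces
    k <= 5. *)
Lemma pos_root W E Z b v0 : positive W E Z b v0 ->
  (6 %| (sum_on b W + (cut_size Z W)%:Z)%R)%Z /\ cut_size Z W <= 5.
Proof.
move=> p; have := well_formed_sum p; have := admissible_root p.
by rewrite (outflow_enter (pos_enter p) (subxx _)) /dist6; clear; lia.
Qed.

(** Given slack, the hypothesis leaves d(A) = 6 with tau(A) = 0 and d(A) = 7 with
    tau(A) = -1.  Lifting a pair at the contracted A is then affordable and yields an
    arc leaving A.  Deleting this arc before the extension into A makes the root
    condition d(A) - 1 <= 4 + |tau(A) - 1| true, and the tail of the arc can afford it. *)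
Lemma solve_leaving W E Z b v0 A : solves_below W E Z ->
  positive W E Z b v0 -> A \subset W -> 1 < #|A| -> A != W ->
  cut_size (E ++ Z) A < 6 + dist6 (sum_on b A - 2)%R -> solvable W E Z b.
Proof.
move=> IH p sA A2 AW hlt.
have [W6 k5] := pos_root p.
have hA : (6 %| sum_on b A)%Z /\ cut_size (E ++ Z) A = 6 \/
          (6 %| (sum_on b A + 1)%R)%Z /\ cut_size (E ++ Z) A = 7.
  have := pos_slack p sA A2 AW; have := par_set p sA.
  by move: hlt; rewrite /dist6; clear; lia.
have [r rA] : exists r, r \in A by apply/set0Pn; rewrite -card_gt0 ltnW.
set W1 := contracted W A r.
set E1 := collapse_arcs A r (edges_off A E); set Z1 := collapse_arcs A r Z.
set b1 := collapse_dem A r b.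
have rW1 : r \in W1 by apply: a0_contracted.
have sub1 x : x \in W1 -> [set x] \subset W1 by rewrite sub1set.
have crT B : B \subset W1 -> cut_size (E1 ++ Z1) B = cut_size (E ++ Z) (collapse A r @^-1: B).
  exact: cut_size_collapse.
have pre_r : collapse A r @^-1: [set r] = A by rewrite (preim_mem (W := W)) // eqxx.
have crr : cut_size (E1 ++ Z1) [set r] = cut_size (E ++ Z) A by rewrite crT ?sub1 // pre_r.
have br : b1 r = sum_on b A by rewrite /b1 /collapse_dem eqxx.
have crEr : cut_size E1 [set r] = cut_size E A.
  by rewrite cut_size_map pre_r cut_size_edges_off.
have crZA : cut_size Z A <= 5.
  by apply: leq_trans k5; rewrite (crZ_setD p sA) leq_addr.
have [|||||||||D1 [sD1 hD1 [a aD1 /andP[/eqP a1 a2]]]] := @lift_at V W1 E1 Z1 b1 r rW1.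
- move=> W' E' Z' b' w lt; apply: IH; apply: ltn_trans lt _.
  exact: weight_contract.
- exact: (well_formed_contract sA rA p).
- rewrite (sum_on_collapse (W := W) b rA) // cut_size_map (preim_full sA rA); exact: admissible_root p.
- move=> B sB B0 BW nB; rewrite crT // (sum_on_collapse (W := W) b rA) //.
  apply: (pos_firm p) (preim_sub sA rA sB) _ (preim_proper sB BW).
  case/set0Pn: B0 => x xB; apply/set0Pn; exists x.
  have := contracted_sub (subsetP sB x xB); rewrite inE /collapse.
  by case: ifP => // _ /andP[_ /orP[/eqP <-|]].
- move=> B sB B2 BW; rewrite crT // (sum_on_collapse (W := W) b rA) //.
  apply: (pos_slack p) (preim_sub sA rA sB) _ (preim_proper sB BW).
  case: (boolP (r \in B)) => rB; last by rewrite (preim_out sB rB).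
  by rewrite (preim_in rA sB rB); apply: leq_trans A2 (subset_leq_card (subsetUl _ _)).
- right; rewrite br crr; move: hA; rewrite /dist6; clear; lia.
- by rewrite crEr; move: hA; rewrite cut_size_cat; move: crZA; clear; lia.
- by rewrite crr; move: hA; clear; lia.
- move=> x xW1 nxr; rewrite crr !crT ?subUset ?sub1set ?xW1 ?rW1 //.
  have /andP[xW] := contracted_sub xW1; rewrite (negbTE nxr) /= => xA.
  rewrite (preim_mem _ _ xW1) // (negbTE nxr).
  rewrite (preim_in (W := W) rA) ?subUset ?sub1set ?xW1 ?rW1 ?inE ?eqxx //.
  have -> : [set r; x] :\ r = [set x].
    by apply/setP => z; rewrite !inE; case: (z =P r) => [->|//]; rewrite eq_sym (negbTE nxr).
  have [t ht [hb hx]] := pos_deg p xW; rewrite hx => he.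
  have h0 : cut_size (E ++ Z) (A :|: [set x]) = 0 by move: hA ht he; clear; lia.
  have sAx : A :|: [set x] \subset W by rewrite subUset sA sub1set.
  have Ax0 : A :|: [set x] != set0 by apply/set0Pn; exists x; rewrite !inE eqxx orbT.
  case: (eqVneq (A :|: [set x]) W) => [eW|nW]; last first.
    by have := pos_firm p sAx Ax0 nW; rewrite h0.
  have := W6; rewrite -{1}eW sum_onU; last by rewrite disjoint_sym disjoints1.
  rewrite sum_on1; move: h0; rewrite eW cut_size_cat => h0.
  by move: h0 he hA ht hb; rewrite eW cut_size_cat; clear; lia.
have [D [sD pD hAsum hout]] := contract_lift sA rA sD1 hD1.
have [c cDZ [c1 c2]] : exists2 c, c \in D ++ Z & (c.1 \in A) /\ (c.2 \notin A).
  have : a \in collapse_arcs A r (D ++ Z).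
    by rewrite /collapse_arcs map_cat mem_cat (perm_mem pD) -mem_cat.
  case/mapP => c cDZ ac; exists c => //; split.
    move: a1; rewrite ac /= /collapse; case: ifP => // cA cut_size; by rewrite cut_size rA in cA.
  by apply: contraNN a2 => cA; rewrite ac /= /collapse cA.
have pc := perm_to_rem cDZ; set Y := rem c (D ++ Z) in pc.
apply: (glue sA sD hout); apply: (solvable_perm pc); apply: solvable_drop.
have wA : well_formed A (edges_in A E) (c :: Y) b.
  by apply: (well_formed_same (same_graph_refl _) pc); exact: (well_formed_extend p sA sD hAsum).
have crY B : B \subset A -> (c.1 \in B : nat) + cut_size (edges_in A E ++ Y) B = cut_size (E ++ Z) B.
  move=> sB; rewrite -(cut_size_extend _ _ sD) [in RHS]cut_size_cat (cut_size_perm _ pc) cut_size_cons cut_size_cat.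
  have /negbTE -> : c.2 \notin B by apply: contra c2; apply: (subsetP sB).
  by rewrite addbF addnCA.
have netc B : B \subset A -> outflow [:: c] B = ((c.1 \in B : nat)%:Z)%R.
  move=> sB; rewrite outflow_arc.
  have /negbTE -> : c.2 \notin B by apply: contra c2; apply: (subsetP sB).
  by rewrite subr0.
apply: (IH _ _ _ _ v0).
  have sAW : #|A| < #|W| by apply: proper_card; rewrite properEneq AW.
  have := size_extend Z sD; have := perm_size pc; rewrite /weight /=.
  by move: sAW; clear; lia.
split; first exact: well_formed_drop.
  have := crY A (subxx _); rewrite c1 sum_on_demand_after netc // c1.
  rewrite cut_size_cat (@cut_size_in _ (edges_in A E)); last first.
    by apply/allP => e; rewrite mem_filter => /andP[].
  by move: hA; rewrite /dist6; clear; lia.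
move=> B sB B0 BA; left; rewrite sum_on_demand_after netc //.
have sBW := subset_trans sB sA.
have BW : B != W by apply: contraNneq AW => BW; rewrite eqEsubset sA -{1}BW; exact: sB.
have := pos_firm p sBW B0 BW; rewrite -(crY B sB); case cB : (c.1 \in B); last first.
  by rewrite subr0.
case: (ltnP 1 #|B|) => [B2|B1] _.
  have := pos_slack p sBW B2 BW; rewrite -(crY B sB) cB.
  by rewrite /dist6; clear; lia.
have /cards1P [u Bu] : #|B| == 1 by rewrite eqn_leq B1 card_gt0.
have := pos_can_out p (x := u); rewrite -sub1set -Bu => /(_ sBW).
rewrite /can_out -Bu -(crY B sB) cB Bu sum_on1 /dist6; clear; lia.
Qed.

End Positive.

(** * Absorbing a vertex into the root *)

Section Absorption.
Variable V : finType.
Implicit Types (e a : V * V) (E F D Z L : seq (V * V)) (A B W : {set V}) (b : V -> int).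

Lemma positive_same W E F Z b v0 : same_graph E F -> positive W E Z b v0 -> positive W F Z b v0.
Proof.
move=> s [h1 h2 h3 h4 h5]; split => //.
- exact: admissible_same s (perm_refl _) h1.
- exact: firm_same s (perm_refl _) h2.
- exact: slack_same s (perm_refl _) h3.
by move=> x /h4; rewrite !cut_size_cat (cut_size_same _ s).
Qed.

Lemma outflow_into (ys : seq V) x : x \notin ys ->
  outflow [seq (y, x) | y <- ys] [set x] = (- (size ys)%:Z)%R.
Proof.
elim: ys => [|y ys IH]; first by rewrite outflow_nil.
rewrite inE negb_or eq_sym => /andP[/negbTE nyx /IH h].
by rewrite /= outflow_cons h /= !inE eqxx nyx; clear; lia.
Qed.

Lemma outflow_from (ys : seq V) x : x \notin ys ->
  outflow [seq (x, y) | y <- ys] [set x] = ((size ys)%:Z)%R.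
Proof.
elim: ys => [|y ys IH]; first by rewrite outflow_nil.
rewrite inE negb_or eq_sym => /andP[/negbTE nyx /IH h].
by rewrite /= outflow_cons h /= !inE eqxx nyx; clear; lia.
Qed.

Lemma same_graph_heads (ys : seq V) x : same_graph (map (pair x) ys) [seq (y, x) | y <- ys].
Proof.
by elim: ys => [|y ys IH] //=; apply: (@same_graph_rev _ (x, y)).
Qed.

(** Let j be the number of arcs from the root to x.  Orienting 5 - j free edges into x
    and the others out of it balances x, since 5 is 2 modulo 3 and every vertex needs
    indegree 2 modulo 3.  Deleting two of the new arcs then brings the enlarged
    root back to its bound. *)
Lemma solve_absorb W E Z b v0 : solves_below W E Z ->
  positive W E Z b v0 ->
  (forall A, A \subset W -> 1 < #|A| -> A != W ->
     6 + dist6 (sum_on b A - 2)%R <= cut_size (E ++ Z) A) ->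
  (2 < #|W|) -> solvable W E Z b.
Proof.
move=> IH p hs W3; have W2 := ltnW W3; have [W6 k5] := pos_root p.
have [x xW hx] : exists2 x, x \in W & (0 < cut_size Z [set x]) || (cut_size Z W == 0).
  case: (posnP (cut_size Z W)) => [k0|kpos].
    by have /set0Pn [x xW] : W != set0 by [rewrite -card_gt0 ltnW]; exists x; rewrite ?k0 ?orbT.
  have /hasP [a aZ aW] : has (fun e => (e.1 \in W) (+) (e.2 \in W)) Z by rewrite has_count.
  have /negbTE a1 := pos_enter p aZ; rewrite a1 /= in aW.
  exists a.2 => //; apply/orP; left; rewrite -has_count; apply/hasP; exists a => //.
  by rewrite !inE eqxx addbT; apply: contraFN a1 => /eqP ->.
have [|ys [E' [sE xys hE']]] := @star_decomposition _ E x.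
  by apply: sub_all (well_formed_free p) => e /and3P[].
apply: (solvable_same sE).
have {}IH : solves_below W (map (pair x) ys ++ E') Z.
  by move=> ? ? ? ? ? h; apply: IH; move: h; rewrite /weight (same_graph_size sE).
have {}hs A : A \subset W -> 1 < #|A| -> A != W ->
     6 + dist6 (sum_on b A - 2)%R <= cut_size ((map (pair x) ys ++ E') ++ Z) A.
  by rewrite cut_size_cat -(cut_size_same _ sE) -cut_size_cat; apply: hs.
have {}p := positive_same sE p.
have := well_formed_free p; rewrite all_cat all_map => /andP[ysW E'W] {sE E}.
set E := map (pair x) ys ++ E' in IH hs p *.
set A := W :\ x; have sA : A \subset W by apply: subD1set.
have xA : x \notin A by rewrite !inE eqxx.
have ysA : all [in A] ys.
  by apply: sub_all ysW => y /= /and3P[_ yW nxy]; rewrite !inE eq_sym nxy yW.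
have E'A : all (inside A) E'.
  apply/allP => e eE'; have /and3P[e1 e2 _] := allP E'W _ eE'.
  by have /andP[n1 n2] := allP hE' _ eE'; rewrite /inside !inE n1 n2 e1 e2.
have in_E' : edges_in A E = E'.
  rewrite filter_cat filter_map (eq_filter (a2 := pred0)) ?filter_pred0 /=; last first.
    by move=> y; rewrite /= /inside /= (negbTE xA).
  exact/all_filterP.
have off_E : edges_off A E = map (pair x) ys.
  have E'out : edges_off A E' = [::].
    by apply/eqP; rewrite -(negbK (_ == _)) -has_filter has_predC negbK.
  rewrite filter_cat E'out cats0; apply/all_filterP; rewrite all_map.
  by apply/allP => y _ /=; rewrite /inside /= (negbTE xA).
have [t ht [hb dx]] := pos_deg p xW.
have crZx := crZ_D1 p xW; rewrite -/A in crZx.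
have crE'x : cut_size E' [set x] = 0.
  by apply: cut_size_out; apply: sub_all hE' => e; rewrite !inE.
have crEx : cut_size E [set x] = size ys.
  rewrite cut_size_cat crE'x addn0 cut_size_star // inE eqxx.
  by apply/eqP; rewrite -all_count; apply: sub_all ysA => y /=; rewrite !inE => /andP[].
have dx' : size ys + cut_size Z [set x] = 4 + t by rewrite -dx cut_size_cat crEx.
have cardA : #|A| = #|W|.-1 by rewrite [in RHS](cardsD1 x) xW.
have A0 : A != set0 by rewrite -card_gt0 cardA; move: W2; clear; lia.
have nAW : A != W by apply: contraTneq xW => <-.
set j := cut_size Z [set x] in hx crZx dx'.
have j3 : j <= 3.
  have := pos_firm p sA A0 nAW; rewrite cut_size_cat (crE_D1 p xW) crEx.
  by move: k5 crZx dx' ht; clear; lia.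
(* The arcs from y1 and y2 to x are the two to be deleted. *)
have [y1 [y2 [zs eys]]] : exists y1 y2 zs, ys = [:: y1, y2 & zs].
  move: ht dx' j3; clear; case: ys => [|y1 [|y2 zs]] /= h0 h1 h2.
  - by exfalso; lia.
  - by exfalso; lia.
  by exists y1, y2, zs.
have szs : size zs = 2 + t - j by move: dx'; rewrite eys /=; clear; lia.
(* y1 and y2 and the first q vertices of zs send an arc to x: 2 + q + j = 5. *)
pose q := 3 - j.
have qz : q <= size zs by rewrite szs /q; move: ht j3; clear; lia.
pose D2 := [seq (y, x) | y <- take q zs] ++ [seq (x, y) | y <- drop q zs].
pose D := [:: (y1, x), (y2, x) & D2].
have sD : same_graph (edges_off A E) D.
  rewrite off_E eys /D /=; apply: (@same_graph_rev _ (x, y1)); apply: (@same_graph_rev _ (x, y2)).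
  rewrite -{1}(cat_take_drop q zs) map_cat; apply: same_graph_cat; last exact: same_graph_refl.
  exact: same_graph_heads.
have xzs : x \notin zs by move: xys; rewrite eys !inE !negb_or => /and3P[].
have [y1A y2A zsA] : [/\ y1 \in A, y2 \in A & all [in A] zs].
  by move: ysA; rewrite eys /= => /and3P[].
have ny1 : (y1 == x) = false by apply: contraNF xA => /eqP <-.
have ny2 : (y2 == x) = false by apply: contraNF xA => /eqP <-.
have netx : (6 %| (outflow (D ++ Z) [set x] - b x)%R)%Z.
  rewrite outflow_cat !outflow_cons outflow_cat outflow_into; last by apply: contra xzs; apply: mem_take.
  rewrite outflow_from; last by apply: contra xzs; apply: mem_drop.
  rewrite !inE /= ny1 ny2 eqxx (outflow_enter (pos_enter p)) ?sub1set // -/j.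
  rewrite size_takel // size_drop szs /q.
  by move: ht hb j3; clear; lia.
have hA := absorb_sum p xW sD netx.
have off_x z : z \in W :\: A -> z = x.
  by rewrite !inE negb_and negbK => /andP[/orP[/eqP ->|/negbTE ->]].
apply: (glue sA sD); first by move=> z /off_x ->.
have szlt := size_absorb Z xW sD.
rewrite -[D ++ Z]/[:: (y1, x), (y2, x) & D2 ++ Z].
apply: solvable_drop; apply: solvable_drop.
have wfA := well_formed_drop (well_formed_drop (well_formed_extend p sA sD hA)).
set b2 := demand_after _ _ in wfA *.
have bE B : B \subset A -> sum_on b2 B =
    (sum_on b B - (y1 \in B : nat)%:Z - (y2 \in B : nat)%:Z)%R.
  move=> sB; have /negbTE xB : x \notin B by apply: contra xA; apply: (subsetP sB).
  by rewrite !sum_on_demand_after !outflow_arc /= xB !subr0.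
have crE B : B \subset A -> (y1 \in B : nat) + ((y2 \in B : nat) +
    cut_size (edges_in A E ++ D2 ++ Z) B) = cut_size (E ++ Z) B.
  move=> sB; have /negbTE xB : x \notin B by apply: contra xA; apply: (subsetP sB).
  rewrite -(cut_size_extend _ _ sD) /D [in RHS]cut_size_cat !cut_size_cons /= xB !addbF [in LHS]cut_size_cat.
  by rewrite (addnCA (cut_size _ _)) (addnCA (cut_size _ _)).
apply: (IH _ _ _ _ v0).
  by apply: leq_ltn_trans szlt; rewrite /weight -/A leq_add2l /= -addn2 leq_addr.
split => //.
  have := crE A (subxx _); rewrite y1A y2A cut_size_cat in_E'.
  rewrite [in X in _ = X]cut_size_cat (crE_D1 p xW) crEx bE // y1A y2A.
  rewrite (@cut_size_in _ E' A); last first.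
    by rewrite -in_E'; apply/allP => e; rewrite mem_filter => /andP[].
  have := sum_onD1 b xW; rewrite -/A => bW.
  by move: W6 hb ht hx k5 crZx dx' j3; rewrite bW /dist6; clear; lia.
move=> B sB B0 BA; left; rewrite bE //.
have sBW := subset_trans sB sA.
have BW : B != W by apply: contraNneq nAW => BW; rewrite eqEsubset sA -{1}BW; exact: sB.
have := pos_firm p sBW B0 BW; have := crE B sB.
case: (ltnP 1 #|B|) => [B2|B1].
  have := pos_slack p sBW B2 BW; have := hs B sBW B2 BW.
  case: (y1 \in B); case: (y2 \in B) => /=; rewrite /dist6; clear; lia.
have /cards1P [u Bu] : #|B| == 1 by rewrite eqn_leq B1 card_gt0.
have uW : u \in W by rewrite -sub1set -Bu.
have := pos_can_out p uW; rewrite /can_out -Bu.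
have -> : sum_on b B = b u by rewrite Bu sum_on1.
case e1 : (y1 \in B); case e2 : (y2 \in B); try by rewrite /dist6 /=; clear; lia.
move: e1 e2; rewrite Bu !inE => /eqP y1u /eqP y2u.
have nux : u != x by rewrite -y1u ny1.
have [tu htu [hbu du]] := pos_deg p uW; rewrite du.
(* Both deleted arcs come from u, so x and u are joined by two edges; slack for
   the pair shows that this happens only if the boundary of u is 2. *)
suff t2 : tu = 2 by move: hbu; rewrite t2 /dist6; clear; lia.
pose C := [set x; u]; have C2 : #|C| = 2 by rewrite cards2 eq_sym nux.
have sC : C \subset W by rewrite subUset !sub1set xW uW.
have CW : C != W by apply: contraTneq W3 => <-; rewrite C2.
have := pos_slack p sC _ CW; rewrite C2 => /(_ isT).
rewrite sum_onU ?disjoints1 ?inE 1?eq_sym // !sum_on1.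
have : cut_size (E ++ Z) C + 4 <= cut_size (E ++ Z) [set x] + cut_size (E ++ Z) [set u].
  have := cut_size_subadd (map (pair x) zs ++ E' ++ Z) [set x] [set u].
  rewrite /E eys y1u y2u /= -!catA !cut_size_cons !inE /= !eqxx (eq_sym x) (negbTE nux) /= -/C.
  by clear; lia.
by rewrite dx du; move: hb hbu ht htu; rewrite /dist6; clear; lia.
Qed.

End Absorption.

(** * The extension theorem *)

Section Extension.
Variable V : finType.
Implicit Types (e a : V * V) (E F D Z L : seq (V * V)) (A B W : {set V}) (b : V -> int).

Definition opp_demand b : V -> int := fun x => (- b x)%R.

Lemma sum_on_opp b A : sum_on (opp_demand b) A = (- sum_on b A)%R.
Proof. exact: sumrN. Qed.

Lemma cut_size_rev L A : cut_size (map rev_arc L) A = cut_size L A.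
Proof. by rewrite /cut_size count_map; apply: eq_count => a /=; rewrite addbC. Qed.

Lemma same_graph_map_rev E F : same_graph E F -> same_graph E (map rev_arc F).
Proof.
move=> s; rewrite /same_graph -map_comp (eq_map (g := @ends_of V)) // => a; exact: ends_of_rev.
Qed.

Lemma dist6N (c : int) : dist6 (- c)%R = dist6 c.
Proof. by rewrite /dist6; clear; lia. Qed.

Lemma cut_size_revZ E Z A : cut_size (E ++ map rev_arc Z) A = cut_size (E ++ Z) A.
Proof. by rewrite !cut_size_cat cut_size_rev. Qed.

Lemma admissible_opp W E Z b v0 : admissible W E Z b v0 ->
  admissible W E (map rev_arc Z) (opp_demand b) v0.
Proof.
case=> -[h1 h2 h3 h4] h5 h6; split; first split=> //.
- by rewrite all_map; apply: sub_all h2 => a /=; rewrite andbC.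
- by move=> x /h3; rewrite cut_size_revZ /opp_demand; clear; lia.
- by move: h4; rewrite outflow_rev sum_on_opp; clear; lia.
- by rewrite cut_size_rev sum_on_opp dist6N.
move=> A sA A0 AW; rewrite cut_size_revZ sum_on_opp dist6N.
case: (h6 A sA A0 AW) => [|[eA hb]]; first by left.
by right; split=> //; move: hb; rewrite /opp_demand; clear; lia.
Qed.

Lemma solvable_opp W E Z b :
  solvable W E (map rev_arc Z) (opp_demand b) -> solvable W E Z b.
Proof.
case=> D sD h; exists (map rev_arc D); first exact: same_graph_map_rev.
by move=> x /h; rewrite !outflow_cat !outflow_rev /opp_demand; clear; lia.
Qed.

Lemma can_out_opp E Z b x : can_out E (map rev_arc Z) (opp_demand b) x = can_in E Z b x.
Proof.
rewrite /can_out /can_in cut_size_revZ /opp_demand -(dist6N (b x + 1)%R).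
by congr (5 + dist6 _ <= _); clear; lia.
Qed.

(** If some vertex can also lose an incoming arc, then a free edge at it can be
    deleted; otherwise all boundaries are 1 or 2. *)
Lemma solve_out W E Z b v0 : solves_below W E Z -> admissible W E Z b v0 ->
  2 < #|W| -> firm W E Z b -> slack W E Z b ->
  (forall x, x \in W -> ~~ (6 %| b x)%Z) ->
  (forall x, x \in W -> can_out E Z b x) -> solvable W E Z b.
Proof.
move=> IH g W3 h1 hs nz hout.
case: (boolP [exists x in W, can_in E Z b x]) => [/exists_inP [x xW hx]|noin].
  have x0 : [set x] != set0 by rewrite -cards_eq0 cards1.
  have xnW : [set x] != W by apply: contraTneq W3 => <-; rewrite cards1.
  have [|[u v] eE] := free_crossing g h1 _ x0 xnW; first by rewrite sub1set.
  have /and3P[/= uW vW _] := allP (well_formed_free g) _ eE.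
  rewrite !inE /=; case: (eqVneq u x) => [eu|_] /=; last move=> /eqP ev; subst.
    by move=> _; apply: (solve_free IH g h1 hs eE (or_intror erefl)) => //; apply: hout.
  by apply: (solve_free IH g h1 hs eE (or_introl erefl)) => //; apply: hout.
case: (boolP (has (fun a => a.1 \in W) Z)) => [/hasP [a aZ aW]|noZ].
  by apply: (solve_fixed IH g h1 hs aZ); rewrite aW hout.
have p : positive W E Z b v0.
  split=> //; last by move=> a aZ; have := hasPn noZ a aZ.
  move=> x xW.
  have x0 : [set x] != set0 by rewrite -cards_eq0 cards1.
  have xnW : [set x] != W by apply: contraTneq W3 => <-; rewrite cards1.
  have := h1 [set x] _ x0 xnW; rewrite sub1set xW sum_on1 => /(_ isT) dx.
  have : ~~ can_in E Z b x by apply: contraNN noin => hx; apply/exists_inP; exists x.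
  have := well_formed_par g xW; have := nz x xW; rewrite /can_in => b6 par nin.
  exists `|modz (b x) 6|%N; move: b6 par nin dx; rewrite /dist6; clear; lia.
case: (boolP [forall A : {set V}, (A \subset W) && (1 < #|A|) && (A != W) ==>
    (6 + dist6 (sum_on b A - 2)%R <= cut_size (E ++ Z) A)]) => [/forallP hA|].
  apply: (solve_absorb IH p) => //.
  by move=> A sA A2 AW; have := hA A; rewrite sA A2 AW.
case/forallPn => A; rewrite negb_imply -ltnNge => /andP[/andP[/andP[sA A2] AW] hlt].
exact: solve_leaving IH p sA A2 AW hlt.
Qed.

(** The extension theorem of Lovasz, Thomassen, Wu and Zhang for modulus 3.  If no
    free edge can be deleted, then by connectedness all vertices can lose an outgoing
    arc, or all an incoming one; these cases are exchanged by reversal. *)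
Theorem orientation_extension W E Z b v0 : admissible W E Z b v0 -> solvable W E Z b.
Proof.
have [n] := ubnP (weight W E Z); elim: n W E Z b v0 => // n IHn W E Z b v0 hn g.
have IH : solves_below W E Z.
  by move=> W' E' Z' b' w hw; apply: IHn; apply: leq_trans hw hn.
case: (ltngtP #|W| 2) => [W1|W3|W2]; last exact: solve_two_vertices W2 g.
  exact: solve_one_vertex W1 g.
case: (boolP [forall A : {set V}, (A \subset W) && (1 < #|A|) && (A != W) ==>
    (6 + dist6 (sum_on b A) <= cut_size (E ++ Z) A)]) => [/forallP hA|]; last first.
  case/forallPn => A; rewrite negb_imply -ltnNge => /andP[/andP[/andP[sA A2] AW] hlt].
  exact: solve_tight IH g sA A2 AW hlt.
have {hA} hs : slack W E Z b.
  by move=> A sA A2 AW; have := hA A; rewrite sA A2 AW.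
case: (boolP [exists v in W, (6 %| b v)%Z]) => [/exists_inP[v vW b6]|].
  exact: solve_zero IH g W3 hs vW b6.
rewrite negb_exists => /forallP nz0.
have {nz0} nz x : x \in W -> ~~ (6 %| b x)%Z.
  by move=> xW; have := nz0 x; rewrite xW.
have h1 : firm W E Z b.
  move=> A sA A0 AW; case: (admissible_cut g sA A0 AW) => // -[eA b6].
  by have := nz v0; rewrite -sub1set -eA sA b6 => /(_ isT).
have either x : x \in W -> can_out E Z b x || can_in E Z b x.
  move=> xW.
  have x0 : [set x] != set0 by rewrite -cards_eq0 cards1.
  have xnW : [set x] != W by apply: contraTneq W3 => <-; rewrite cards1.
  have := h1 [set x] _ x0 xnW; rewrite sub1set xW sum_on1 => /(_ isT).
  have := nz x xW; rewrite /can_in /can_out /dist6; clear; lia.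
pose A := [set x in W | can_out E Z b x].
have sA : A \subset W by apply/subsetP => x; rewrite inE => /andP[].
case: (eqVneq A W) => [eA|nAW].
  apply: (solve_out IH g) => // x; rewrite -{1}eA inE.
  by case/andP.
case: (eqVneq A set0) => [eA|nA0].
  apply: solvable_opp; apply: (@solve_out _ _ _ _ v0) => //.
  - move=> W' E' Z' b' w; rewrite [weight W E _]/weight size_map; exact: IH.
  - exact: admissible_opp.
  - by move=> B sB B0 BW; rewrite cut_size_revZ sum_on_opp dist6N; apply: h1.
  - by move=> B sB B0 BW; rewrite cut_size_revZ sum_on_opp dist6N; apply: hs.
  - by move=> x /nz; rewrite /opp_demand; clear; lia.
  move=> x xW; rewrite can_out_opp; have := either x xW.
  by have : x \notin A by [rewrite eA inE]; rewrite inE xW /= => /negbTE ->.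
have [[u v] eE] := free_crossing g h1 sA nA0 nAW.
have /and3P[/= uW vW _] := allP (well_formed_free g) _ eE.
have := either u uW; have := either v vW; rewrite !inE /= uW vW /=.
case ou : (can_out E Z b u); case ov : (can_out E Z b v) => //= hv hu _.
  exact: solve_free IH g h1 hs eE (or_introl erefl) ou hv.
exact: solve_free IH g h1 hs eE (or_intror erefl) ov hu.
Qed.

End Extension.

(** * Indexed edges and balanced orientations *)

Section Balanced.
Variables V F : finType.
Implicit Types (g : F -> V * V) (o : F -> bool) (A B W X : {set V}).

Definition cutF g X : {set F} := [set e | ((g e).1 \in X) (+) ((g e).2 \in X)].
Definition arcF g o (e : F) : V * V := if o e then g e else rev_arc (g e).
Definition flow g o X : int := outflow [seq arcF g o e | e <- enum F] X.
Definition sgnF g o X (e : F) : int := outflow [:: arcF g o e] X.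
Definition cutsF g k : {set {set F}} := [set C | [exists X, C == cutF g X] && (#|C| == k)].
Definition balanced g o W := forall x, x \in W -> (3 %| flow g o [set x])%Z.

Lemma flowE g o X : flow g o X = (\sum_e sgnF g o X e)%R.
Proof.
rewrite /flow /outflow big_map big_enum /=; apply: eq_bigr => e _.
by rewrite /sgnF outflow_arc.
Qed.

Lemma sgnF_cut g o X e : e \notin cutF g X -> sgnF g o X e = 0%R.
Proof.
rewrite inE /sgnF outflow_arc /arcF; case: (o e) => /=;
  by case: (_ \in X); case: (_ \in X).
Qed.

Lemma sgnF_eq g o o' X e : e \in cutF g X ->
  (o e == o' e) = (sgnF g o X e == sgnF g o' X e).
Proof.
rewrite inE /sgnF !outflow_arc /arcF.
by case: (o e); case: (o' e) => /=; case: (_ \in X); case: (_ \in X).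
Qed.

Lemma sgnF_bound g o X e : e \in cutF g X -> sgnF g o X e = 1%R \/ sgnF g o X e = (-1)%R.
Proof.
rewrite inE /sgnF outflow_arc /arcF; case: (o e) => /=;
  by case: (_ \in X); case: (_ \in X) => //= _; auto.
Qed.

Lemma eq_flow g o o' X : {in cutF g X, o =1 o'} -> flow g o X = flow g o' X.
Proof.
move=> h; rewrite !flowE; apply: eq_bigr => e _.
case: (boolP (e \in cutF g X)) => eX; last by rewrite !sgnF_cut.
by apply/eqP; rewrite -sgnF_eq // h.
Qed.

Lemma sgnFN g o X e : sgnF g (fun e => ~~ o e) X e = (- sgnF g o X e)%R.
Proof. by rewrite /sgnF !outflow_arc /arcF; case: (o e) => /=; rewrite opprB. Qed.

Lemma flowN g o X : flow g (fun e => ~~ o e) X = (- flow g o X)%R.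
Proof. by rewrite !flowE -sumrN; apply: eq_bigr => e _; rewrite sgnFN. Qed.

Lemma cut_size_arcF (s : seq F) g o X : cut_size [seq arcF g o e | e <- s] X = count [in cutF g X] s.
Proof.
rewrite /cut_size count_map; apply: eq_count => e; rewrite /= !inE /arcF.
by case: (o e) => //=; rewrite addbC.
Qed.

Lemma cut_size_gF (s : seq F) g X : cut_size [seq g e | e <- s] X = count [in cutF g X] s.
Proof. by rewrite /cut_size count_map; apply: eq_count => e; rewrite /= !inE. Qed.

Lemma cut_size_flow g o X : cut_size [seq arcF g o e | e <- enum F] X = #|cutF g X|.
Proof. by rewrite cut_size_arcF -sum1_count big_enum_cond /= sum1_card. Qed.

Lemma flow_parity g o X : (2 %| (flow g o X - #|cutF g X|%:Z)%R)%Z.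
Proof. by rewrite -(cut_size_flow g o); apply: outflow_parity. Qed.

Lemma flow_le g o X : `|flow g o X|%N <= #|cutF g X|.
Proof. by rewrite -(cut_size_flow g o); apply: abs_net_le. Qed.

Lemma flow_rest g o X e :
  flow g o X = (sgnF g o X e + \sum_(f | f != e) sgnF g o X f)%R.
Proof. by rewrite flowE (bigD1 e). Qed.

(** Each of the other edges of the cut contributes 1 or -1; with this bound the sign of
    one edge can be read from the outflow of a small cut. *)
Lemma flow_rest_lt g o X e : e \in cutF g X ->
  `|(\sum_(f | f != e) sgnF g o X f)%R|%N < #|cutF g X|.
Proof.
move=> eX; rewrite (cardsD1 e) eX add1n ltnS.
have -> : (\sum_(f | f != e) sgnF g o X f = \sum_(f in cutF g X :\ e) sgnF g o X f)%R.
  rewrite (bigID [in cutF g X]) /= [X in (_ + X)%R]big1 ?addr0.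
    by apply: eq_bigl => f; rewrite !inE andbC.
  by move=> f /andP[_]; exact: sgnF_cut.
rewrite -sum1_card; elim/big_rec2: _ => // f m z fX.
have {fX} /(sgnF_bound o) fX : f \in cutF g X by move: fX; rewrite inE => /andP[].
by case: fX => ->; clear; lia.
Qed.

Lemma flow_full g o W : (forall e, ((g e).1 \in W) && ((g e).2 \in W)) -> flow g o W = 0%R.
Proof.
move=> h; rewrite flowE big1 // => e _; apply: sgnF_cut.
by rewrite inE; have /andP[-> ->] := h e.
Qed.

Lemma flowD1 g o x X : x \in X -> flow g o X = (flow g o [set x] + flow g o (X :\ x))%R.
Proof. exact: outflowD1. Qed.

Lemma flow_dvd g o X : (forall x, x \in X -> (3 %| flow g o [set x])%Z) -> (3 %| flow g o X)%Z.
Proof.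
move=> h; rewrite /flow outflow_sum; apply: rpred_sum => x xX; exact: h.
Qed.

Definition cutdeg g A : int := sum_on (fun x => (3 * #|cutF g [set x]|%:Z)%R) A.

(** The boundary 3 deg is 0 modulo 3 and has the parity of the degree.  Degrees in A
    add up to the size of the cut modulo 2, as outflows do exactly. *)
Lemma cutdeg_parity g A : (6 %| (cutdeg g A - 3 * #|cutF g A|%:Z)%R)%Z.
Proof.
pose o := fun _ : F => true.
have h : (2 %| (flow g o A - sum_on (fun x => #|cutF g [set x]|%:Z) A)%R)%Z.
  by apply: outflow_eq_sum_on => x _; apply: flow_parity.
have := flow_parity g o A.
have -> : cutdeg g A = (3 * sum_on (fun x => #|cutF g [set x]|%:Z) A)%R.
  by rewrite /cutdeg /sum_on mulr_sumr.
by move: h; clear; lia.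
Qed.

(** Recovers an orientation of the indexed edges s from an oriented list of
    their images, leaving the other edges as they are in o. *)
Lemma read_orientation g (s : seq F) D o : uniq s -> same_graph [seq g e | e <- s] D ->
  exists o', (forall e, e \notin s -> o' e = o e) /\
    perm_eq D [seq arcF g o' e | e <- s].
Proof.
rewrite /same_graph -map_comp perm_sym => us /perm_map_align [D' pD eD].
suff [o' [h eo]] : exists o', (forall e, e \notin s -> o' e = o e) /\
    D' = [seq arcF g o' e | e <- s].
  by exists o'; split => //; rewrite -eo.
elim: s D' us eD {pD} => [|e s IH] [|d D'] //=; first by exists o.
move=> /andP[es us] [/ends_ofP ed /IH] /(_ us) [o' [h ->]].
exists (fun f => if f == e then d == g e else o' f); split.
  by move=> f; rewrite inE negb_or => /andP[/negbTE -> /h].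
congr (_ :: _).
  rewrite /arcF eqxx; case: eqP => // ne; case: ed => //.
apply/eq_in_map => f fs; rewrite /arcF; case: eqP => // fe.
by rewrite -fe fs in es.
Qed.

(** The hypothesis in a form inherited by contractions, which keep the index type of
    the edges.  Cuts of contractions are cuts of the original graph. *)
Record few_cuts g W : Prop := FewCuts {
  few_ends : forall e, ((g e).1 \in W) && ((g e).2 \in W);
  few_bridge : forall X, #|cutF g X| != 1;
  few_weight : 2 * #|cutsF g 3| + #|cutsF g 5| <= 7 }.

Definition collapseF A (r : V) g : F -> V * V :=
  fun e => (collapse A r (g e).1, collapse A r (g e).2).

Lemma cutF_collapse A r g X : cutF (collapseF A r g) X = cutF g (collapse A r @^-1: X).
Proof. by apply/setP => e; rewrite !inE. Qed.

Lemma flow_collapse A r g o X :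
  flow (collapseF A r g) o X = flow g o (collapse A r @^-1: X).
Proof.
rewrite !flowE; apply: eq_bigr => e _; rewrite /sgnF !outflow_arc /arcF !inE.
by case: (o e) => /=.
Qed.

Lemma few_collapse g W A r : A \subset W -> r \in A -> few_cuts g W ->
  few_cuts (collapseF A r g) (contracted W A r).
Proof.
move=> sA rA [h1 h2 h3]; split.
- by move=> e; rewrite /= !(collapse_in_W sA rA).
- by move=> X; rewrite cutF_collapse.
have sub k : cutsF (collapseF A r g) k \subset cutsF g k.
  apply/subsetP => C; rewrite !inE => /andP[/existsP[X /eqP ->] ->].
  by rewrite andbT; apply/existsP; exists (collapse A r @^-1: X); rewrite cutF_collapse.
by apply: leq_trans h3; rewrite leq_add ?leq_mul2l ?subset_leq_card.
Qed.

Lemma balanced_collapse g W A r o : A \subset W -> r \in A ->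
  balanced (collapseF A r g) o (contracted W A r) ->
  (3 %| flow g o A)%Z /\ forall x, x \in W :\: A -> (3 %| flow g o [set x])%Z.
Proof.
move=> sA rA h; split.
  have := h r (a0_contracted sA rA).
  by rewrite flow_collapse (preim_mem sA rA (a0_contracted sA rA)) eqxx.
move=> x; rewrite inE => /andP[xA xW].
have xc : x \in contracted W A r by rewrite !inE xW (negbTE xA) andbF.
have := h x xc; rewrite flow_collapse (preim_mem sA rA xc).
by case: eqP => // xr; rewrite xr rA in xA.
Qed.

End Balanced.

Definition solves_smaller (V F : finType) (W : {set V}) :=
  forall (W' : {set V}) (g' : F -> V * V), #|W'| < #|W| -> few_cuts g' W' ->
  W' \subset W -> exists o, balanced g' o W'.

(** * Removing 0-, 2- and 3-cuts and large sides of small cuts *)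

Section Reductions.
Variables V F : finType.
Implicit Types (g : F -> V * V) (o : F -> bool) (A B W X : {set V}).

Lemma card_contracted_lt W A (r : V) : A \subset W -> r \in A -> 1 < #|A| ->
  #|contracted W A r| < #|W|.
Proof. by move=> sA rA A2; have := card_contracted sA rA; move: A2; clear; lia. Qed.

Lemma solve_contracted g W A : solves_smaller F W -> few_cuts g W -> A \subset W -> 1 < #|A| ->
  exists o, (3 %| flow g o A)%Z /\ forall x, x \in W :\: A -> (3 %| flow g o [set x])%Z.
Proof.
move=> IH h sA A2; have [r rA] : exists r, r \in A by apply/set0Pn; rewrite -card_gt0 ltnW.
have [|o ho] := IH _ _ (card_contracted_lt sA rA A2) (few_collapse sA rA h).
  exact: subsetDl.
by exists o; apply: (balanced_collapse sA rA).
Qed.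

(** Merge a vertex x of A with a vertex y outside A, the ends of a cut edge e if there
    is one.  The direction of e does not affect the merged graph and can be chosen
    so that A is balanced; then x is balanced, and so is y. *)
Lemma solve_small_cut g W A : solves_smaller F W -> few_cuts g W ->
  A \subset W -> A != set0 -> A != W -> (#|cutF g A| == 0) || (#|cutF g A| == 2) ->
  exists o, balanced g o W.
Proof.
move=> IH h sA A0 AW hA.
have [x [y [xA yW yA hxy]]] : exists x y, [/\ x \in A, y \in W, y \notin A &
   cutF g A != set0 -> exists2 e, e \in cutF g A & g e = (x, y) \/ g e = (y, x)].
  case: (set_0Vmem (cutF g A)) => [c0|[e eA]].
    have [x xA] := set0Pn _ A0.
    have /subsetPn [y yW yA] : ~~ (W \subset A).
      by apply: contraNN AW => sW; rewrite eqEsubset sA.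
    by exists x, y; split => //; rewrite c0 eqxx.
  have /andP[] := few_ends h e; have := eA; rewrite inE.
  case E : (g e) => [u v] /=; case: (boolP (u \in A)) => uA /= vA uW vW.
    exists u, v; split => // _; exists e => //; by left.
  by exists v, u; split => // _; exists e => //; right.
have nyx : y != x by apply: contraNneq yA => ->.
have xW := subsetP sA x xA.
have sxy : [set x; y] \subset W by rewrite subUset !sub1set xW yW.
have [|o [oxy oW]] := solve_contracted IH h sxy; first by rewrite cards2 eq_sym nyx.
suff [o' [oA o'xy o'W]] : exists o', [/\ (3 %| flow g o' A)%Z, (3 %| flow g o' [set x; y])%Z &
    forall z, z \in W :\: [set x; y] -> (3 %| flow g o' [set z])%Z].
  exists o'.
  have o'x : (3 %| flow g o' [set x])%Z.
    have := flowD1 g o' xA.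
    have : (3 %| flow g o' (A :\ x))%Z.
      apply: flow_dvd => z; rewrite !inE => /andP[nzx zA]; apply: o'W.
      by rewrite !inE negb_or nzx (subsetP sA) // andbT; apply: contraNneq yA => <-.
    by move: oA; clear; lia.
  move=> z zW; case: (boolP (z \in [set x; y])) => hz; last by apply: o'W; rewrite inE hz.
  case/set2P: hz => -> //.
  have := flowD1 g o' (set21 x y); rewrite setU1K ?inE 1?eq_sym //.
  by move: o'x o'xy; clear; lia.
case/orP: hA => cA.
  exists o; split => //; have := flow_le g o A; rewrite (eqP cA).
  by clear; lia.
have [|e eA exy] := hxy; first by rewrite -card_gt0 (eqP cA).
pose o' f := if f == e then ~~ o e else o f.
have off X : e \notin cutF g X -> flow g o' X = flow g o X.
  by move=> eX; apply: eq_flow => f fX; rewrite /o'; case: eqP => // fe; rewrite -fe fX in eX.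
have exy' : e \notin cutF g [set x; y].
  by rewrite inE; case: exy => -> /=; rewrite !inE !eqxx !orbT.
have ez z : z \in W :\: [set x; y] -> e \notin cutF g [set z].
  rewrite !inE negb_or => /andP[/andP[nzx nzy] _].
  by case: exy => -> /=; rewrite !(eq_sym _ z) (negbTE nzx) (negbTE nzy).
have e1 := flow_rest g o A e; have b1 := flow_rest_lt o eA.
have e2 := flow_rest g o' A e.
have er : (\sum_(f | f != e) sgnF g o' A f = \sum_(f | f != e) sgnF g o A f)%R.
  by apply: eq_bigr => f /negbTE fe; rewrite /sgnF /arcF /o' fe.
rewrite {}er in e2; move: (\sum_(f | _) _)%R => r in e1 e2 b1.
have sN : sgnF g o' A e = (- sgnF g o A e)%R.
  by rewrite -sgnFN /sgnF /arcF /o' eqxx.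
have := sgnF_bound o eA; have := flow_parity g o A; rewrite (eqP cA) in b1 *.
rewrite e1 => par hs.
have [h0|h0] : flow g o A = 0%R \/ flow g o' A = 0%R.
  by move: par hs b1; rewrite e1 e2 sN; clear; lia.
- by exists o; split => //; rewrite h0.
exists o'; split; first by rewrite h0.
- by rewrite off.
by move=> z hz; rewrite off ?ez // oW.
Qed.

Lemma flow_setD g o W A : (forall e, ((g e).1 \in W) && ((g e).2 \in W)) -> A \subset W ->
  (flow g o A + flow g o (W :\: A) = 0)%R.
Proof.
move=> h sA; rewrite -outflowU; last by rewrite disjoint_sym disjoints_subset subsetDr.
rewrite -{1}(setIidPr sA) setID; exact: flow_full.
Qed.

Lemma flow_extreme g o A e : #|cutF g A| = 3 -> flow g o A = 3%R ->
  e \in cutF g A -> sgnF g o A e = 1%R.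
Proof.
move=> c3 f3 eA; have := flow_rest_lt o eA; have := flow_rest g o A e.
by rewrite f3 c3; have := sgnF_bound o eA; clear; lia.
Qed.

(** A balanced orientation directs all three cut edges the same way, so after
    reversing if needed the orientations of the two contractions agree on the cut. *)
Lemma glue_3cut g W A : solves_smaller F W -> few_cuts g W ->
  A \subset W -> 1 < #|A| -> 1 < #|W :\: A| -> #|cutF g A| = 3 ->
  exists o, balanced g o W.
Proof.
move=> IH h sA A2 B2 c3.
have norm X : (exists o, (3 %| flow g o A)%Z /\ forall x, x \in X -> (3 %| flow g o [set x])%Z) ->
    exists o, flow g o A = 3%R /\ forall x, x \in X -> (3 %| flow g o [set x])%Z.
  case=> o [oA oX]; have le := flow_le g o A; have par := flow_parity g o A.
  rewrite c3 in le par.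
  have [e3|e3] : flow g o A = 3%R \/ flow g o A = (-3)%R by move: oA le par; clear; lia.
    by exists o.
  exists (fun e => ~~ o e); rewrite flowN e3; split => // x /oX.
  by rewrite flowN; clear; lia.
have [o1 [f1 h1]] := norm _ (solve_contracted IH h sA A2).
have [o2 [f2 h2]] : exists o, flow g o A = 3%R /\ forall x, x \in A -> (3 %| flow g o [set x])%Z.
  apply: norm; have [o [oB oA]] := solve_contracted IH h (subsetDl W A) B2.
  exists o; split; first by have := flow_setD o (few_ends h) sA; move: oB; clear; lia.
  by move=> x xA; apply: oA; rewrite !inE xA (subsetP sA).
pose o e := if ((g e).1 \in A) || ((g e).2 \in A) then o2 e else o1 e.
exists o => x xW; case: (boolP (x \in A)) => xA.
  rewrite (@eq_flow _ _ g o o2); first exact: h2.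
  move=> e; rewrite inE /o => ex; suff -> : ((g e).1 \in A) || ((g e).2 \in A) by [].
  by move: ex; rewrite !inE; case: eqP => [->|_] /=; [rewrite xA | move=> /eqP ->; rewrite xA orbT].
rewrite (@eq_flow _ _ g o o1); first by apply: h1; rewrite inE xA.
move=> e; rewrite inE /o => ex; case: ifP => // eA.
have eC : e \in cutF g A.
  move: ex eA; rewrite !inE; case: (eqVneq (g e).1 x) => [->|_] /=.
    by rewrite (negbTE xA) => _ /= ->.
  by move=> /eqP ->; rewrite (negbTE xA) orbF => ->.
by apply/eqP; rewrite (sgnF_eq _ _ eC) !flow_extreme.
Qed.

(** The extension theorem with boundary zero, for the instance on A whose
    pre-oriented arcs are the edges not inside A. *)
Lemma extend_flow g o W A : (forall e, ((g e).1 \in W) && ((g e).2 \in W)) ->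
  A \subset W -> (3 %| flow g o A)%Z -> odd #|cutF g A| -> #|cutF g A| <= 7 ->
  (forall B, B \subset A -> B != set0 -> B != A ->
     4 + 3 * odd #|cutF g B| <= #|cutF g B|) ->
  (forall x, x \in W :\: A -> (3 %| flow g o [set x])%Z) ->
  exists o', balanced g o' W.
Proof.
move=> hW sA oA odA leA hB hout.
(* Loops inside A are neither free nor pre-oriented: they contribute nothing. *)
pose p e := inside A (g e) && ((g e).1 != (g e).2).
pose s := [seq e <- enum F | p e]; pose r := [seq e <- enum F | predC p e].
pose E := [seq g e | e <- s].
pose Z := [seq arcF g o e | e <- r & ~~ inside A (g e)].
have psr : perm_eq (s ++ r) (enum F) by rewrite perm_filterC.
have outflow_r X : X \subset A -> outflow [seq arcF g o e | e <- r] X = outflow Z X.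
  move=> sX; rewrite -(outflow_perm X (perm_map (arcF g o) (permEl (perm_filterC (fun e => ~~ inside A (g e)) r)))).
  rewrite map_cat outflow_cat -/Z -[RHS]addr0; congr (_ + _)%R.
  rewrite /outflow big_map big1_seq // => e; rewrite !mem_filter /= negbK.
  case/and3P => ine; rewrite /p ine negbK => /eqP eq _.
  by rewrite /arcF; case: (o e); rewrite /= eq subrr.
have crEZ X : X \subset A -> cut_size (E ++ Z) X = #|cutF g X|.
  move=> sX; rewrite -(cut_size_flow g o) -(cut_size_perm X (perm_map (arcF g o) psr)) map_cat !cut_size_cat.
  congr (_ + _); first by rewrite cut_size_gF cut_size_arcF.
  rewrite !cut_size_arcF [LHS]count_filter; apply: eq_in_count => e.
  rewrite mem_filter => /andP[/= pe _]; case: (boolP (inside A (g e))) => [ine|_]; last by rewrite andbT.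
  move: pe; rewrite /p ine negbK => /eqP eq.
  by rewrite andbF inE eq addbb.
have netZA : outflow Z A = flow g o A.
  rewrite -outflow_r // /flow -(outflow_perm A (perm_map (arcF g o) psr)) map_cat outflow_cat.
  rewrite (@outflow_in _ [seq arcF g o e | e <- s]) ?add0r //.
  rewrite all_map; apply/allP => e; rewrite mem_filter => /andP[/andP[ine _] _] /=.
  by move: ine; rewrite /inside /arcF; case: (o e) => //=; rewrite andbC.
pose b x := (3 * #|cutF g [set x]|%:Z)%R.
have bB B : dist6 (sum_on b B) = 3 * odd #|cutF g B|.
  by have := cutdeg_parity g B; rewrite -/b /cutdeg -/b /dist6; clear; lia.
have [v0 v0A] : exists x, x \in A.
  apply/set0Pn; apply/eqP => A0; move: odA.
  suff -> : cutF g A = set0 by rewrite cards0.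
  by apply/setP => e; rewrite A0 !inE.
have [D sD hD] : solvable A E Z b.
  apply: (@orientation_extension _ _ _ _ _ v0); split; first split.
  - rewrite all_map; apply/allP => e; rewrite mem_filter => /andP[/andP[/andP[e1 e2] ne] _] /=.
    by rewrite e1 e2.
  - rewrite all_map; apply/allP => e; rewrite mem_filter => /andP[ine _] /=.
    by move: ine; rewrite /inside /arcF; case: (o e) => //=; rewrite andbC.
  - by move=> x xA; rewrite crEZ ?sub1set // /b; clear; lia.
  - rewrite netZA; have := cutdeg_parity g A; have := flow_parity g o A.
    by rewrite /cutdeg -/b; move: oA; clear; lia.
  - have : cut_size Z A <= cut_size (E ++ Z) A by rewrite cut_size_cat leq_addl.
    by rewrite crEZ // bB odA; move: leA; clear; lia.
  by move=> B sB B0 BA; left; rewrite crEZ // bB; apply: hB.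
have [o' [o'o pD]] := read_orientation o (filter_uniq _ (enum_uniq F)) sD.
exists o' => x xW; case: (boolP (x \in A)) => xA.
  have := hD x xA; rewrite outflow_cat (outflow_perm _ pD).
  rewrite -outflow_r ?sub1set // -outflow_cat.
  have -> : [seq arcF g o e | e <- r] = [seq arcF g o' e | e <- r].
    apply/eq_in_map => e; rewrite mem_filter /arcF => /andP[/= pe _].
    by rewrite o'o // mem_filter negb_and pe.
  rewrite -map_cat (outflow_perm _ (perm_map _ psr)) -/(flow _ _ _) /b.
  by clear; lia.
rewrite (@eq_flow _ _ g o' o); first by apply: hout; rewrite inE xA.
move=> e; rewrite inE => ex; apply: o'o; rewrite mem_filter negb_and.
apply/orP; left; rewrite /p /inside; apply/negP => /andP[/andP[e1 e2] _].
move: ex; rewrite !inE; case: (eqVneq (g e).1 x) => [e1x|_] /=; first by rewrite -e1x e1 in xA.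
by move=> /eqP e2x; rewrite -e2x e2 in xA.
Qed.

Definition small g A := (#|cutF g A| == 3) || (#|cutF g A| == 5).

(** A minimal side of a small cut inside A has at least two vertices and contains no
    further small cut, so the extension theorem applies to it. *)
Lemma solve_no_small_vertex g W A : solves_smaller F W -> few_cuts g W ->
  (forall B, B \subset W -> B != set0 -> B != W -> 2 < #|cutF g B|) ->
  A \subset W -> A != set0 -> A != W -> small g A ->
  (forall x, x \in A -> ~~ small g [set x]) -> exists o, balanced g o W.
Proof.
move=> IH h h2 sA A0 AW smA nsm.
pose P (B : {set V}) := (B != set0) && small g B.
have [C /minsetP[/andP[C0 smC] minC] sC] : {C | minset P C & C \subset A}.
  by apply: minset_exists; rewrite /P A0.
have sCW := subset_trans sC sA.
have CW : C != W by apply: contraNneq AW => CW; rewrite eqEsubset sA -CW.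
have C2 : 1 < #|C|.
  rewrite ltnNge; apply/negP => C1.
  have /cards1P [x Cx] : #|C| == 1 by rewrite eqn_leq C1 card_gt0.
  by have := nsm x; rewrite -sub1set -Cx smC => /(_ sC).
have [o [oC oout]] := solve_contracted IH h sCW C2.
apply: (extend_flow (few_ends h) sCW oC _ _ _ oout).
- by case/orP: smC => /eqP ->.
- by case/orP: smC => /eqP ->.
move=> B sB B0 BC.
have BW : B != W by apply: contraNneq CW => BW; rewrite eqEsubset sCW -{1}BW.
have := h2 B (subset_trans sB sCW) B0 BW.
have : ~~ small g B.
  by apply: contraNN BC => smB; apply/eqP; apply: minC => //; rewrite /P B0.
rewrite /small; move: #|cutF g B| => n; clear; lia.
Qed.

End Reductions.

(** * Signed weights for the arcs of an additional vertex *)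

Section Weights.
Variable T : finType.
Implicit Types (A B S N : {set T}) (s : T -> int) (c : T -> nat).

Definition abs_sum_on s A : nat := \sum_(x in A) `|s x|%N.

Lemma abs_sum_onD1 s x A : x \in A -> abs_sum_on s A = `|s x|%N + abs_sum_on s (A :\ x).
Proof. by move=> xA; rewrite /abs_sum_on (big_setD1 x). Qed.

Lemma sum_on_abs_bound s A : `|sum_on s A|%N <= abs_sum_on s A /\ (2 %| (sum_on s A - (abs_sum_on s A)%:Z)%R)%Z.
Proof.
rewrite /sum_on /abs_sum_on; elim/big_rec2: _ => // x n m _ [].
by clear; lia.
Qed.

(** The sign tells the direction of the arcs between the new vertex and x, the absolute
    value their number, at least c x.  With 6 or 7 arcs, the vertices of a set N of
    weight 2 get the opposite sign, which makes the total 2 or 3; up to 5 arcs may have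
    equal signs.  With at most two vertices all weights are 2, as a single vertex of
    weight 1 would not satisfy the last condition. *)
Lemma signed_weights S c :
  (forall x, x \in S -> 0 < c x <= 2) -> (2 < #|S| -> \sum_(x in S) c x <= 7) ->
  exists s, [/\ forall x, x \notin S -> s x = 0%R,
    forall x, x \in S -> c x <= `|s x|%N <= 2,
    abs_sum_on s S <= 4 + dist6 (sum_on s S) &
    forall x, x \in S -> c x = 2 -> S :\ x != set0 ->
      2 < abs_sum_on s (S :\ x) \/ abs_sum_on s (S :\ x) = 2 /\ `|sum_on s (S :\ x)|%N = 2].
Proof.
move=> hc h7.
(* At most 4 arcs in total: no condition at the root. *)
case: (leqP #|S| 2) => [S2|S3].
  pose s x : int := if x \in S then 2%R else 0%R.
  have asumE A : A \subset S -> abs_sum_on s A = #|A| * 2.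
    move=> sA; rewrite -sum_nat_const; apply: eq_bigr => x xA.
    by rewrite /s (subsetP sA).
  have bsumE A : A \subset S -> sum_on s A = ((#|A| * 2)%N%:Z)%R.
    move=> sA; rewrite -asumE // /abs_sum_on (big_morph Posz PoszD (erefl _)).
    by apply: eq_bigr => x xA; rewrite /s (subsetP sA).
  exists s; split.
  - by move=> x /negbTE xS; rewrite /s xS.
  - by move=> x xS; rewrite /s xS; have /andP[_ ->] := hc x xS.
  - by rewrite asumE //; move: S2; clear; lia.
  move=> x xS _; rewrite -card_gt0 asumE ?bsumE ?subD1set // => h.
  by move: h; clear; lia.
have {h7} := h7 S3; set k := \sum_(x in S) c x => k7.
have [N [sN hN]] : exists N, N \subset S /\
    (k <= 5 /\ N = set0 \/ 5 < k /\ \sum_(x in N) c x = 2).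
  case: (leqP k 5) => k5; first by exists set0; split; [exact: sub0set | left].
  case: (boolP [exists x in S, c x == 2]) => [/exists_inP[x xS /eqP cx]|n2].
    by exists [set x]; rewrite sub1set xS big_set1; split => //; right.
  have c1 x : x \in S -> c x = 1.
    move=> xS; have : c x != 2 by apply: contraNN n2 => cx; apply/exists_inP; exists x.
    by have := hc x xS; clear; lia.
  have [x [y [xS yS nxy]]] : exists x y, [/\ x \in S, y \in S & x != y].
    by have [x [y [? ? ?]]] := card_gt1P (ltnW S3); exists x, y.
  exists [set x; y]; rewrite subUset !sub1set xS yS; split => //; right; split => //.
  by rewrite big_setU1 ?inE //= big_set1 !c1.
pose s x : int := if x \in S then if x \in N then (- (c x)%:Z)%R else ((c x)%:Z)%R else 0%R.
have absS x : x \in S -> `|s x|%N = c x.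
  by move=> xS; rewrite /s xS; case: (x \in N); clear; lia.
have asumS : abs_sum_on s S = k by apply: eq_bigr => x xS; rewrite absS.
have bsumS : sum_on s S = (k%:Z - 2 * (\sum_(x in N) c x)%N%:Z)%R.
  rewrite /sum_on /k (big_setID N) (big_setID (A := S) N) /= (setIidPr sN).
  have -> : (\sum_(x in N) s x = - (\sum_(x in N) c x)%N%:Z)%R.
    rewrite (big_morph Posz PoszD (erefl _)) -sumrN; apply: eq_bigr => x xN.
    by rewrite /s (subsetP sN) // xN.
  have -> : (\sum_(x in S :\: N) s x = (\sum_(x in S :\: N) c x)%N%:Z)%R.
    rewrite (big_morph Posz PoszD (erefl _)); apply: eq_bigr => x.
    by rewrite inE /s => /andP[/negbTE -> ->].
  by clear; lia.
exists s; split.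
- by move=> x /negbTE xS; rewrite /s xS.
- by move=> x xS; rewrite absS // leqnn; have /andP[] := hc x xS.
- rewrite asumS bsumS; case: hN => [[k5 ->]|[k6 ->]].
    by rewrite big_set0; move: k5; rewrite /dist6; clear; lia.
  by move: k6 k7; rewrite /dist6; clear; lia.
move=> x xS cx _.
have := abs_sum_onD1 s xS; rewrite absS // cx asumS => ek.
case: hN => [[k5 N0]|[k6 _]]; last by left; move: ek k6; clear; lia.
have a2 : 2 <= abs_sum_on s (S :\ x).
  have cS : #|S :\ x| = #|S|.-1 by rewrite [in RHS](cardsD1 x) xS.
  apply: (@leq_trans #|S :\ x|); first by move: cS S3; clear; lia.
  rewrite -sum1_card; apply: leq_sum => y; rewrite inE => /andP[_ yS].
  by rewrite absS //; have /andP[] := hc y yS.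
have eb : sum_on s (S :\ x) = ((abs_sum_on s (S :\ x))%:Z)%R.
  rewrite /abs_sum_on (big_morph Posz PoszD (erefl _)); apply: eq_bigr => y.
  rewrite inE => /andP[_ yS]; rewrite absS // /s yS N0 inE //.
by rewrite eb; move: a2; clear; lia.
Qed.

End Weights.

(** * Balanced orientations of graphs with few small cuts *)

Section Main.
Variables V F : finType.
Implicit Types (g : F -> V * V) (o : F -> bool) (A B W X : {set V}).

(** Two vertices with the same boundary would together have an empty boundary. *)
Lemma cutF1_inj g W x y : few_cuts g W -> 2 < #|W| ->
  (forall B, B \subset W -> B != set0 -> B != W -> 2 < #|cutF g B|) ->
  x \in W -> y \in W -> cutF g [set x] = cutF g [set y] -> x = y.
Proof.
move=> h W3 h2 xW yW exy; apply/eqP/negPn/negP => nxy.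
have c2 : #|[set x; y]| = 2 by rewrite cards2 nxy.
have := h2 [set x; y]; rewrite subUset !sub1set xW yW => /(_ isT).
rewrite -card_gt0 c2 => /(_ isT).
have -> : [set x; y] != W by apply: contraTneq W3 => <-; rewrite c2.
have -> : cutF g [set x; y] = set0.
  apply/setP => e; move/setP/(_ e): exy; rewrite !inE.
  case: (eqVneq (g e).1 x) => [->|_]; case: (eqVneq (g e).2 x) => [->|_] //=;
    by rewrite ?(negbTE nxy) //=; case: (_ == y) => //; case: (_ == y).
by rewrite cards0 => /(_ isT).
Qed.

Lemma outflow_nseqs (z : V) (s : V -> int) (r : seq V) A : z \notin A ->
  outflow (flatten [seq nseq `|s x|%N (if (0 <= s x)%R then (z, x) else (x, z)) | x <- r]) A =
    (- \sum_(x <- r) if x \in A then s x else 0)%R.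
Proof.
move=> /negbTE zA; elim: r => [|x r IH]; first by rewrite outflow_nil big_nil oppr0.
rewrite /= outflow_cat IH outflow_nseq big_cons.
by case: ifP => sx; case: ifP => xA; rewrite /= ?zA ?xA; move: sx; clear; lia.
Qed.

Lemma cut_size_nseqs (z : V) (s : V -> int) (r : seq V) A : z \notin A ->
  cut_size (flatten [seq nseq `|s x|%N (if (0 <= s x)%R then (z, x) else (x, z)) | x <- r]) A =
    \sum_(x <- r) if x \in A then `|s x|%N else 0.
Proof.
move=> /negbTE zA; elim: r => [|x r IH]; first by rewrite cut_size_nil big_nil.
rewrite /= cut_size_cat IH cut_size_nseq big_cons.
by case: ifP => sx; case: ifP => xA; rewrite /= ?zA ?xA /= ?mul1n ?mul0n.
Qed.

(** z represents the new vertex, and its arcs are the pre-oriented ones. *)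
Lemma solve_weighted g W z (s : V -> int) : z \notin W ->
  (forall e, ((g e).1 \in W) && ((g e).2 \in W)) -> W != set0 ->
  abs_sum_on s W <= 4 + dist6 (sum_on s W) ->
  (forall A, A \subset W -> A != set0 -> A != W ->
     4 + dist6 (3 * #|cutF g A|%:Z - sum_on s A)%R <= #|cutF g A| + abs_sum_on s A) ->
  exists o, balanced g o W.
Proof.
move=> zW hW W0 hroot hcut.
(* Loops cannot be free edges; they are balanced in any orientation. *)
pose sE := [seq e <- enum F | (g e).1 != (g e).2].
pose E := [seq g e | e <- sE].
pose Z := flatten [seq nseq `|s x|%N (if (0 <= s x)%R then (z, x) else (x, z)) | x <- enum V].
pose b x := (3 * #|cutF g [set x]|%:Z - s x)%R.
have zn A : A \subset W -> z \notin A by move=> sA; apply: contra zW; apply: (subsetP sA).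
have crE A : cut_size E A = #|cutF g A|.
  rewrite cut_size_gF count_filter -(cut_size_flow g (fun => true)) cut_size_arcF.
  apply: eq_count => e /=; rewrite inE; case: eqP => [->|_] /=; last by rewrite andbT.
  by rewrite addbb.
have crZ A : A \subset W -> cut_size Z A = abs_sum_on s A.
  by move=> sA; rewrite cut_size_nseqs ?zn // big_enum -big_mkcond.
have netZ A : A \subset W -> outflow Z A = (- sum_on s A)%R.
  by move=> sA; rewrite outflow_nseqs ?zn // big_enum -big_mkcond.
have bE A : (6 %| (sum_on b A - (3 * #|cutF g A|%:Z - sum_on s A))%R)%Z.
  have := cutdeg_parity g A; suff -> : sum_on b A = (cutdeg g A - sum_on s A)%R by clear; lia.
  by rewrite /cutdeg /sum_on sumrB.
have cW : #|cutF g W| = 0.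
  apply/eqP; rewrite cards_eq0; apply/eqP/setP => e; rewrite !inE.
  by have /andP[-> ->] := hW e.
have [v0 v0W] := set0Pn _ W0.
have [D sD hD] : solvable W E Z b.
  apply: (@orientation_extension _ _ _ _ _ v0); split; first split.
  - rewrite all_map; apply/allP => e; rewrite mem_filter => /andP[ne _] /=.
    by rewrite ne andbT; exact: hW.
  - apply/allP => a /flatten_mapP[x _] /nseqP[-> _].
    by case: ifP => _ /=; rewrite (negbTE zW) ?andbF.
  - move=> x xW; rewrite cut_size_cat crE crZ ?sub1set // /b /abs_sum_on big_set1.
    by clear; lia.
  - have := bE W; rewrite netZ // cW; clear; lia.
  - rewrite crZ //; have := dist6_eq (bE W); rewrite cW => ->.
    by rewrite mulr0 sub0r dist6N.
  move=> A sA A0 AW; left; rewrite (dist6_eq (bE A)) cut_size_cat crE crZ //.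
  exact: hcut.
have [o [_ pD]] := read_orientation (fun => true) (filter_uniq _ (enum_uniq F)) sD.
exists o => x xW; have := hD x xW.
rewrite outflow_cat netZ ?sub1set // sum_on1 (outflow_perm _ pD) /b. rewrite -/sE.
have -> : flow g o [set x] = outflow [seq arcF g o e | e <- sE] [set x].
  rewrite /flow -(outflow_perm _ (perm_map (arcF g o) (permEl (perm_filterC (fun e => (g e).1 != (g e).2) (enum F))))).
  rewrite map_cat outflow_cat -[RHS]addr0; congr (_ + _)%R.
  rewrite /outflow big_map big1_seq // => e; rewrite mem_filter /= negbK => /andP[/eqP eq _].
  by rewrite /arcF; case: (o e); rewrite /= eq subrr.
by clear; lia.
Qed.

(** A 5-cut needs weight at least 1 on each side.  A 3-cut around y needs 2 parallel arcs at
    y, and on the other side total weight at least 3 or two arcs in the same direction. *)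
Lemma solve_irreducible g W z : z \notin W -> few_cuts g W -> 1 < #|W| ->
  (forall B, B \subset W -> B != set0 -> B != W -> 2 < #|cutF g B|) ->
  (forall A, A \subset W -> A != set0 -> A != W -> #|cutF g A| = 3 ->
     #|A| <= 1 \/ #|W :\: A| <= 1) ->
  (forall A, A \subset W -> A != set0 -> A != W -> small g A ->
     exists2 x, x \in A & small g [set x]) ->
  exists o, balanced g o W.
Proof.
move=> zW h W2 h2 h3 hsm.
pose S := [set x in W | small g [set x]].
pose c x := if #|cutF g [set x]| == 3 then 2 else 1.
have SW : S \subset W by apply/subsetP => x; rewrite inE => /andP[].
have [||s [s0 sS sroot s3]] := @signed_weights V S c.
- by move=> x _; rewrite /c; case: ifP.
- move=> S3; apply: leq_trans (few_weight h).
  have W3 : 2 < #|W| by apply: leq_trans S3 (subset_leq_card SW).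
  have count_le k : #|[set x in S | #|cutF g [set x]| == k]| <= #|cutsF g k|.
    rewrite -(card_in_imset (f := fun x => cutF g [set x])).
      apply: subset_leq_card; apply/subsetP => C /imsetP[x]; rewrite !inE.
      by case/andP => _ cx ->; rewrite cx andbT; apply/existsP; exists [set x].
    move=> x y; rewrite !inE => /andP[/andP[xW _] _] /andP[/andP[yW _] _].
    exact: cutF1_inj h W3 h2 xW yW.
  apply: (@leq_trans (2 * #|[set x in S | #|cutF g [set x]| == 3]| + #|[set x in S | #|cutF g [set x]| == 5]|)).
    rewrite (bigID (fun x => #|cutF g [set x]| == 3)) /=; apply: leq_add.
      rewrite mulnC -sum_nat_const; apply: eq_leq; apply: eq_big => [x|x /andP[_ c3]].
        by rewrite !inE.
      by rewrite /c c3.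
    rewrite -sum1_card; apply: eq_leq; apply: eq_big => [x|x /andP[_ /negbTE c3]].
      rewrite !inE /small; case: (x \in W) => //=.
      by case: (_ =P 3) => [->|_] //=; rewrite andbb ?andbT.
    by rewrite /c c3.
  by apply: leq_add; rewrite ?leq_mul2l count_le.
have asumI A : A \subset W -> abs_sum_on s A = abs_sum_on s (A :&: S).
  move=> sA; rewrite /abs_sum_on (big_setID S) /= [X in _ + X]big1 ?addn0 // => x.
  by rewrite inE => /andP[/s0 -> _].
have bsumI A : A \subset W -> sum_on s A = sum_on s (A :&: S).
  move=> sA; rewrite /sum_on (big_setID S) /= [X in (_ + X)%R]big1 ?addr0 // => x.
  by rewrite inE => /andP[/s0 -> _].
have WS : W :&: S = S by rewrite (setIidPr SW).
apply: (solve_weighted (z := z) (s := s) zW (few_ends h)).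
- by rewrite -card_gt0 ltnW.
- by rewrite asumI // bsumI // WS.
move=> A sA A0 AW.
have [bA parA] := sum_on_abs_bound s A.
have gt2 := h2 A sA A0 AW.
case: (boolP (small g A)) => [smA|]; last first.
  by move: gt2 bA parA; rewrite /small /dist6; clear; lia.
have [x xA smx] := hsm A sA A0 AW smA.
have xS : x \in S by rewrite inE smx (subsetP sA).
have /andP[cx sx2] := sS x xS.
have ax := abs_sum_onD1 s xA.
have sx1 : 0 < `|s x|%N by apply: leq_trans cx; rewrite /c; case: ifP.
case/orP: smA => /eqP cA; last first.
  by rewrite cA; move: bA parA ax sx1; rewrite /dist6; clear; lia.
case: (h3 A sA A0 AW cA) => cardA.
  have Ax : A = [set x] by apply/eqP; rewrite eq_sym eqEcard sub1set xA cards1.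
  have : 2 <= `|s x|%N by move: cx; rewrite /c -Ax cA eqxx.
  by move: sx2; rewrite cA Ax sum_on1 /abs_sum_on big_set1 /dist6; clear; lia.
have [y Ay] : exists y, W :\: A = [set y].
  apply/cards1P; rewrite eqn_leq cardA card_gt0 setD_eq0.
  by apply: contraNN AW => sW; rewrite eqEsubset sA.
have yWA : y \in W :\: A by rewrite Ay set11.
have [yW yA] : y \in W /\ y \notin A by move: yWA; rewrite inE => /andP[].
have AE : A = W :\ y by rewrite -Ay setDDr setDv set0U (setIidPr sA).
have cy : #|cutF g [set y]| = 3.
  rewrite -cA AE; congr #|pred_of_set _|; apply/setP => e; rewrite !inE.
  have /andP[-> ->] := few_ends h e.
  by rewrite !andbT; case: (_ == y); case: (_ == y).
have yS : y \in S by rewrite inE yW /small cy eqxx.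
have AS : A :&: S = S :\ y by rewrite AE; apply/setP => u; rewrite !inE; case: (u \in W); rewrite ?andbF ?andbT.
have := s3 y yS; rewrite {1}/c cy eqxx => /(_ erefl).
have -> : S :\ y != set0.
  by apply/set0Pn; exists x; rewrite -AS inE xA.
rewrite -AS -asumI // -bsumI // cA => /(_ isT).
by move: parA bA; rewrite /dist6; clear; lia.
Qed.

Theorem balanced_few_cuts g W z : z \notin W -> few_cuts g W -> exists o, balanced g o W.
Proof.
have [n] := ubnP #|W|; elim: n W g => // n IHn W g hn zW h.
have IH : solves_smaller F W.
  move=> W' g' lt h' sW; apply: IHn => //; first exact: leq_trans lt hn.
  by apply: contra zW; apply: (subsetP sW).
case: (leqP #|W| 1) => [W1|W2].
  exists (fun => true) => x xW.
  have Wx : W = [set x] by apply/eqP; rewrite eq_sym eqEcard sub1set xW cards1.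
  by rewrite -Wx flow_full //; exact: few_ends h.
case: (boolP [exists A : {set V}, [&& A \subset W, A != set0, A != W &
    (#|cutF g A| == 0) || (#|cutF g A| == 2)]]) => [/existsP[A /and4P[sA A0 AW cA]]|no2].
  exact: solve_small_cut IH h sA A0 AW cA.
have h2 B : B \subset W -> B != set0 -> B != W -> 2 < #|cutF g B|.
  move=> sB B0 BW; have := few_bridge h B.
  move: no2; rewrite negb_exists => /forallP/(_ B).
  by rewrite sB B0 BW /=; move: #|cutF g B| => m; clear; lia.
case: (boolP [exists A : {set V}, [&& A \subset W, 1 < #|A|, 1 < #|W :\: A| &
    #|cutF g A| == 3]]) => [/existsP[A /and4P[sA A2 B2 /eqP c3]]|no3].
  exact: glue_3cut IH h sA A2 B2 c3.
case: (boolP [exists A : {set V}, [&& A \subset W, A != set0, A != W, small g A &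
    [forall x in A, ~~ small g [set x]]]]) => [/existsP[A /and5P[sA A0 AW smA /forall_inP nsm]]|nosm].
  exact: solve_no_small_vertex IH h h2 sA A0 AW smA nsm.
apply: solve_irreducible zW h W2 h2 _ _ => A sA A0 AW hA.
  move: no3; rewrite negb_exists => /forallP/(_ A).
  rewrite sA hA eqxx andbT /= negb_and -!leqNgt => /orP[]; auto.
move: nosm; rewrite negb_exists => /forallP/(_ A).
rewrite sA A0 AW hA /= negb_forall => /existsP[x].
by rewrite negb_imply negbK => /andP[? ?]; exists x.
Qed.

End Main.

(** * From modulo 3-orientations to nowhere-zero 3-flows *)

Section ThreeFlow.
Variables (G : multigraph) (D : orientation G).
Implicit Types (a : edge G -> bool) (u v w : vertex G) (X : {set vertex G}).

Definition val3 (c : bool) : int := if c then 1%R else (-2)%R.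

Definition excess a X : int :=
  (\sum_e val3 (a e) * ((tail D e \in X : nat)%:Z - (Defs.head D e \in X : nat)%:Z))%R.

(** Exchanging the value of an edge moves three units of excess along a
    residual arc. *)
Definition residual a : rel (vertex G) := fun u v =>
  [exists e, if a e then (tail D e == u) && (Defs.head D e == v)
             else (Defs.head D e == u) && (tail D e == v)].

Lemma excess_sum a X : excess a X = (\sum_(v in X) excess a [set v])%R.
Proof.
rewrite /excess exchange_big /=; apply: eq_bigr => e _.
rewrite (in_sum_pred1 (tail D e)) (in_sum_pred1 (Defs.head D e)).
by rewrite -mulr_sumr sumrB !(big_morph Posz PoszD (erefl _)).
Qed.

Lemma excess_full a : excess a setT = 0%R.
Proof. by apply: big1 => e _; rewrite !inE subrr mulr0. Qed.

Lemma excess_net a v :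
  excess a [set v] = (\sum_(e in out_arcs D v) val3 (a e) - \sum_(e in in_arcs D v) val3 (a e))%R.
Proof.
rewrite [X in (X - _)%R]big_mkcond [X in (_ - X)%R]big_mkcond -sumrB.
by apply: eq_bigr => e _; rewrite !inE; case: (_ == v); case: (_ == v); clear; lia.
Qed.

Lemma excess_mod3 a a' X : (3 %| (excess a X - excess a' X)%R)%Z.
Proof.
rewrite /excess -sumrB; apply: rpred_sum => e _; rewrite -mulrBl dvdz_mulr //.
by case: (a e); case: (a' e).
Qed.

Lemma tail_neq_head e : tail D e != Defs.head D e.
Proof. by have := card_ends e; rewrite (tail_head D) cards2; case: eqP. Qed.

(** On a simple path the exchange of one edge does not affect the later ones, none
    of which meets the first vertex. *)
Lemma push_path a u p : path (residual a) u p -> uniq (u :: p) ->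
  exists a', forall w, excess a' [set w] =
    (excess a [set w] - 3 * (w == u : nat)%:Z + 3 * (w == last u p : nat)%:Z)%R.
Proof.
elim: p a u => [|v p IH] a u; first by move=> _ _; exists a => w /=; clear; lia.
move=> /= /andP[/existsP[e he] pvp] /andP[up uvp].
pose a1 f := if f == e then ~~ a e else a f.
have exc1 w : excess a1 [set w] =
    (excess a [set w] - 3 * (w == u : nat)%:Z + 3 * (w == v : nat)%:Z)%R.
  rewrite /excess (bigD1 e) //= [in RHS](bigD1 e) //=.
  rewrite [X in (_ + X)%R](eq_bigr (fun f => val3 (a f) * ((tail D f \in [set w] : nat)%:Z - (Defs.head D f \in [set w] : nat)%:Z))%R); last first.
    by move=> f /negbTE fe; rewrite /a1 fe.
  rewrite /a1 eqxx !inE; move: (\sum_(_ | _) _)%R => r.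
  have := tail_neq_head e.
  case: (a e) he => /andP[/eqP <- /eqP <-]; rewrite !(eq_sym w) /=;
    by case: (_ == w); case: (_ == w) => _ /=; clear; lia.
have [|a' ha'] := IH a1 v _ uvp.
  apply: (sub_in_path (P := [in v :: p]) (e := residual a)) pvp; last exact/allP.
  move=> x y xP yP /existsP[f hf]; apply/existsP; exists f.
  rewrite /a1; case: (f =P e) => // fe; move: hf; rewrite fe.
  case: (a e) he => /andP[/eqP hu /eqP hv] /andP[/eqP hx /eqP hy];
    by move: xP; rewrite -hx hu /= (negbTE up).
by exists a' => w; rewrite ha' exc1; clear; lia.
Qed.

(** If no vertex of negative excess were reachable from some v of positive excess,
    the reachable set would have positive excess although all edges leaving it carry -2 and all edges
    entering it carry 1. *)
Lemma three_flow_exists : (forall v, (3 %| excess (fun=> true) [set v])%Z) ->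
  exists a, forall v, excess a [set v] = 0%R.
Proof.
move=> h3.
have d3 a v : (3 %| excess a [set v])%Z.
  by have := excess_mod3 a (fun=> true) [set v]; have := h3 v; clear; lia.
pose m a := \sum_v `|excess a [set v]|%N.
suff: forall n a, m a < n -> exists a, forall v, excess a [set v] = 0%R.
  by move/(_ _ (fun=> true) (ltnSn _)).
elim=> // n IH a hm.
case: (boolP [forall v, excess a [set v] == 0%R]) => [/forallP h0|].
  by exists a => v; apply/eqP.
case/forallPn => v0 nv0.
have [v vpos] : exists v, (0 < excess a [set v])%R.
  apply/existsP; apply: contraNT nv0; rewrite negb_exists => /forallP neg.
  have sum0 : (\sum_v - excess a [set v] = 0)%R.
    have := excess_sum a setT; rewrite excess_full sumrN => e0.
    by rewrite (eq_bigl [in [set: vertex G]]) -?e0 ?oppr0 // => x; rewrite !inE.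
  have pos x : true -> (0 <= - excess a [set x])%R.
    by move=> _; have := neg x; clear; lia.
  have := psumr_eq0P pos sum0 (i := v0) isT.
  by move/eqP; rewrite oppr_eq0.
pose R := [set w | connect (residual a) v w].
have vR : v \in R by rewrite inE connect0.
case: (boolP [exists w in R, (excess a [set w] < 0)%R]) => [/exists_inP[w wR wneg]|nneg].
  have := wR; rewrite inE => /connectP[p vp ew].
  case/shortenP: vp ew => p' vp' up' _ ew.
  have [a' ha'] := push_path vp' up'; rewrite -ew in ha'.
  apply: (IH a'); rewrite -ltnS; apply: leq_trans hm; rewrite ltnS /m.
  have nvw : (v == w) = false by apply/eqP => e; move: vpos wneg; rewrite e; clear; lia.
  rewrite (bigD1 v) //= [X in _ < X](bigD1 v) //= -addSn; apply: leq_add.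
    rewrite ha' eqxx nvw; have := d3 a v; move: vpos; clear; lia.
  apply: leq_sum => x nxv; rewrite ha' (negbTE nxv).
  case: (x =P w) => [->|_] /=; last by clear; lia.
  by have := d3 a w; move: wneg; clear; lia.
have : (excess a R <= 0)%R.
  rewrite /excess; apply: sumr_le0 => e _; rewrite !inE.
  case tR : (connect _ v (tail D e)); case hR : (connect _ v (Defs.head D e));
    rewrite ?subrr ?mulr0 //=.
    case ae : (a e) => //=; move: hR.
    rewrite (connect_trans tR) // connect1 //; apply/existsP; exists e.
    by rewrite ae !eqxx.
  case ae : (a e) => //=; move: tR.
  rewrite (connect_trans hR) // connect1 //; apply/existsP; exists e.
  by rewrite ae !eqxx.
rewrite excess_sum (big_setD1 v vR) /=.
have : (0 <= \sum_(w in R :\ v) excess a [set w])%R.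
  apply: sumr_ge0 => w; rewrite inE => /andP[_ wR]; move: nneg.
  by rewrite negb_exists => /forallP/(_ w); rewrite wR /= -leNgt.
move=> ge0 le0; exfalso; move: vpos ge0 le0; move: (excess a _) (\sum_(_ in _) _)%R.
by clear; lia.
Qed.

End ThreeFlow.

Lemma nowhere_zero_of_mod3 (G : multigraph) (D : orientation G) :
  mod3_orientation D -> exists f : edge G -> int, nowhere_zero_3flow D f.
Proof.
move=> h; have [|a ha] := @three_flow_exists G D.
  move=> v; rewrite excess_net; have := h v.
  rewrite /= !sumr_const; clear; lia.
exists (fun e => val3 (a e)); split; first by move=> e; case: (a e).
by move=> v; apply/eqP; rewrite -subr_eq0 -excess_net ha.
Qed.

(** * Multigraphs as indexed edges *)

Section Translate.
Variable G : multigraph.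

(** A path that avoids e cannot leave X. *)
Lemma cut1_bridge (X : {set vertex G}) e : edge_cut X = [set e] -> bridge e.
Proof.
move=> eX; have : e \in edge_cut X by rewrite eX set11.
rewrite inE => /exists_inP[x xX /exists_inP[y yX /eqP ee]].
apply/exists_inP; exists x; first by rewrite ee !inE eqxx.
apply/exists_inP; exists y; first by rewrite ee !inE eqxx orbT.
apply/negP => /connectP[p xp ey]; move: yX; rewrite {}ey inE => /negP; apply.
elim: p x xX xp {ee} => //= z p IH x xX /andP[/existsP[e' /andP[ne ee']] zp].
apply: IH zp; apply: contraNT ne => zX.
have : e' \in edge_cut X.
  rewrite inE; apply/exists_inP; exists x => //; apply/exists_inP; exists z => //.
  by rewrite inE.
by rewrite eX inE.
Qed.

Lemma ends_pair (e : edge G) : exists xy : vertex G * vertex G, ends e == [set xy.1; xy.2].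
Proof.
by have /eqP/cards2P[x [y [_ ->]]] := card_ends e; exists (x, y).
Qed.

Definition end_pair e := xchoose (ends_pair e).
Lemma end_pairP e : ends e = [set (end_pair e).1; (end_pair e).2].
Proof. exact/eqP/(xchooseP (ends_pair e)). Qed.

(** The additional value None serves as the new vertex. *)
Definition end_arc (e : edge G) : option (vertex G) * option (vertex G) :=
  (Some (end_pair e).1, Some (end_pair e).2).

Lemma cutF_edge_cut (X : {set option (vertex G)}) :
  cutF end_arc X = edge_cut [set x | Some x \in X].
Proof.
apply/setP => e; rewrite !inE /= .
have ep := end_pairP e; move: (end_pair e).1 (end_pair e).2 ep => x y ep.
apply/idP/exists_inP.
  case xX : (Some x \in X); case yX : (Some y \in X) => //= _.
    exists x; rewrite ?inE //; apply/exists_inP; exists y; rewrite ?inE ?yX //.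
    by rewrite ep.
  exists y; rewrite ?inE //; apply/exists_inP; exists x; rewrite ?inE ?xX //.
  by rewrite ep setUC.
case=> u; rewrite inE => uX /exists_inP[v]; rewrite !inE => vX /eqP ev.
rewrite ep in ev; have [[-> ->]|[-> ->]] := @ends_ofP _ (x, y) (u, v) ev.
  by rewrite uX (negbTE vX).
by rewrite uX (negbTE vX).
Qed.

(** Sets of vertices with or without None define the same cuts. *)
Lemma few_cuts_end_arc : bridgeless G -> 2 * #|edge_cuts G 3| + #|edge_cuts G 5| <= 7 ->
  few_cuts end_arc [set~ None].
Proof.
move=> nb h; split.
- by move=> e; rewrite !inE.
- move=> X; rewrite cutF_edge_cut; apply/cards1P => -[e /cut1_bridge].
  exact/negP/nb.
have sub k : cutsF end_arc k \subset edge_cuts G k.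
  apply/subsetP => C; rewrite !inE => /andP[/existsP[X /eqP ->] ->].
  by rewrite andbT; apply/existsP; exists [set x | Some x \in X]; rewrite cutF_edge_cut.
by apply: leq_trans h; rewrite leq_add ?leq_mul2l ?subset_leq_card.
Qed.

Lemma orient_ends (o : edge G -> bool) e :
  ends e = [set (if o e then (end_pair e).1 else (end_pair e).2);
                (if o e then (end_pair e).2 else (end_pair e).1)].
Proof. by rewrite end_pairP; case: (o e) => //; rewrite setUC. Qed.

Definition orientation_of (o : edge G -> bool) := Orientation (orient_ends o).

Lemma balanced_mod3 o : balanced end_arc o [set~ None] -> mod3_orientation (orientation_of o).
Proof.
move=> h v; have := h (Some v); rewrite !inE => /(_ isT).
suff -> : flow end_arc o [set Some v] =
   (#|out_arcs (orientation_of o) v|%:Z - #|in_arcs (orientation_of o) v|%:Z)%R.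
  by clear; lia.
rewrite -!sum1_card !(big_morph Posz PoszD (erefl _)).
rewrite [X in (X - _)%R]big_mkcond [X in (_ - X)%R]big_mkcond -sumrB flowE.
apply: eq_bigr => e _; rewrite /sgnF outflow_arc /arcF !inE /=.
by case: (o e); rewrite /= !(inj_eq (@Some_inj _)); case: (_ == v); case: (_ == v).
Qed.

End Translate.

Theorem theorem1p12 (G : multigraph) :
  bridgeless G ->
  2 * #|edge_cuts G 3| + #|edge_cuts G 5| <= 7 ->
  (exists D : orientation G, mod3_orientation D) /\
  (exists (D : orientation G) (f : edge G -> int), nowhere_zero_3flow D f).
Proof.
move=> nb h.
have [|o ho] := @balanced_few_cuts _ _ (@end_arc G) [set~ None] None _ (few_cuts_end_arc nb h).
  by rewrite !inE.
have hD := balanced_mod3 ho.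
split; first by exists (orientation_of o).
by have [f hf] := nowhere_zero_of_mod3 hD; exists (orientation_of o), f.
Qed.
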